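(* Let $k\ge 0$ be an integer and let $f\colon N\to M$ be a non-degenerate PL map between compact polyhedra. Then $f$ is a topological $k$-prem if and only if $f$ is a PL $k$-prem.
   Context: A PL map is called non-degenerate if it has no point-inverses of dimension $>0$. A map $f\colon N\to M$ is a topological (respectively PL) $k$-prem if there exists a map $g\colon N\to\mathbb{R}^k$ such that $f\times g\colon N\to M\times\mathbb{R}^k$, $x\mapsto (f(x),g(x))$, is a topological (respectively PL) embedding, that is, a continuous (respectively PL) map which is a homeomorphism (respectively PL homeomorphism) onto its image. *)

(* Defs.v *)
From HB Require Import structures.
From mathcomp Require Import all_boot all_order all_algebra finmap.
From mathcomp Require Import all_classical all_reals all_analysis.

Set Implicit Arguments.
Unset Strict Implicit.
Unset Printing Implicit Defensive.

Import Order.TTheory GRing.Theory Num.Theory.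
Import numFieldNormedType.Exports.
Local Open Scope classical_set_scope.
Local Open Scope ring_scope.

Definition barycentric (R : realType) (V : normedModType R)
    (s : {fset V}) (w : V -> R) : Prop :=
  (forall v, v \in s -> 0 <= w v) /\ \sum_(v <- s) w v = 1.

(* The hull of the empty set of points is empty. *)
Definition hull (R : realType) (V : normedModType R) (s : {fset V}) : set V :=
  [set x | exists2 w : V -> R, barycentric s w & x = \sum_(v <- s) w v *: v].

Definition affinely_independent (R : realType) (V : normedModType R)
    (s : {fset V}) : Prop :=
  forall w : V -> R, \sum_(v <- s) w v = 0 -> \sum_(v <- s) w v *: v = 0 ->
    forall v, v \in s -> w v = 0.

(* A simplex is represented by its (nonempty) set of vertices. *)
Definition is_simplex (R : realType) (V : normedModType R)
    (s : {fset V}) : Prop :=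
  s != fset0 /\ affinely_independent s.

(* Finite geometric simplicial complexes. In the last clause the common
   vertices span a common face of s and t, or the intersection is empty. *)
Definition simplicial_complex (R : realType) (V : normedModType R)
    (K : {fset {fset V}}) : Prop :=
  [/\ forall s, s \in K -> is_simplex s,
      forall s t, s \in K -> fsubset t s -> t != fset0 -> t \in K &
      forall s t, s \in K -> t \in K -> hull s `&` hull t = hull (fsetI s t)].

Definition triangulates (R : realType) (V : normedModType R)
    (K : {fset {fset V}}) (X : set V) : Prop :=
  simplicial_complex K /\ X = [set x | exists2 s, s \in K & hull s x].

Definition compact_polyhedron (R : realType) (V : normedModType R)
    (X : set V) : Prop :=
  exists K : {fset {fset V}}, triangulates K X.

Definition linear_on (R : realType) (V W : normedModType R)
    (s : {fset V}) (f : V -> W) : Prop :=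
  forall w : V -> R, barycentric s w ->
    f (\sum_(v <- s) w v *: v) = \sum_(v <- s) w v *: f v.

(* Maps between subsets are represented by functions on the ambient spaces;
   the values outside the domain X are irrelevant. A PL map is linear on each
   simplex of some triangulation of its domain; continuity on X is automatic,
   as X is covered by finitely many closed simplices. *)
Definition PL_map (R : realType) (V W : normedModType R)
    (X : set V) (Y : set W) (f : V -> W) : Prop :=
  f @` X `<=` Y /\
  exists2 K : {fset {fset V}}, triangulates K X &
    forall s, s \in K -> linear_on s f.

Definition topological_map (R : realType) (V W : normedModType R)
    (X : set V) (Y : set W) (f : V -> W) : Prop :=
  f @` X `<=` Y /\ {within X, continuous f}.

(* The dimension of a polyhedron: the largest d such that X contains a
   d-simplex. The empty set has no dimension in nat. *)
Definition has_dimension (R : realType) (V : normedModType R)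
    (X : set V) (d : nat) : Prop :=
  (exists s : {fset V}, [/\ is_simplex s, #|` s| = d.+1 & hull s `<=` X]) /\
  (forall s : {fset V}, is_simplex s -> hull s `<=` X -> (#|` s| <= d.+1)%N).

Definition non_degenerate (R : realType) (V W : normedModType R)
    (X : set V) (f : V -> W) : Prop :=
  ~ exists y d, (0 < d)%N /\ has_dimension (X `&` f @^-1` [set y]) d.

Definition topological_embedding (R : realType) (V W : normedModType R)
    (X : set V) (Y : set W) (F : V -> W) : Prop :=
  topological_map X Y F /\
  exists2 G : W -> V, topological_map (F @` X) X G &
    forall x, X x -> G (F x) = x.

Definition PL_embedding (R : realType) (V W : normedModType R)
    (X : set V) (Y : set W) (F : V -> W) : Prop :=
  PL_map X Y F /\
  exists2 G : W -> V, PL_map (F @` X) X G &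
    forall x, X x -> G (F x) = x.

(* M x R^k is the subset M `*` setT of the product normed space. The map g is
   automatically continuous (resp. PL), being a component of f x g. *)
Definition topological_prem (R : realType) (V W : normedModType R) (k : nat)
    (N : set V) (M : set W) (f : V -> W) : Prop :=
  exists g : V -> 'rV[R]_k,
    topological_embedding N (M `*` [set: 'rV[R]_k]) (fun x => (f x, g x)).

Definition PL_prem (R : realType) (V W : normedModType R) (k : nat)
    (N : set V) (M : set W) (f : V -> W) : Prop :=
  exists g : V -> 'rV[R]_k,
    PL_embedding N (M `*` [set: 'rV[R]_k]) (fun x => (f x, g x)).

(* Main.v *)
(* Let g be continuous with f x g injective.  Interpolating g linearly on a fine
   triangulation can fail near points where sheets of f merge: there the
   differences d = g(p) - g(q) of two sheets tend to 0 while their direction may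
   vary.  So the triangulation must be graded.

   Let K triangulate N with f linear, hence injective, on each simplex, and let H
   be finitely many affine functionals on R^m such that each f(s), s in K, is a
   union of cells of the arrangement of H.  Start from a big simplex containing
   f(N) and use only edge bisections.  First make each simplex lie on one side of
   each h in H.  Then, for j = 0, 1, ..., bisect the edges whose endpoints have at
   least j nonzero functionals until they are short.  At stage j the simplices
   spanned by such vertices cover a compact set C that no longer grows, and is
   disjoint from the cells with fewer than j nonzero functionals; so on the points
   of C with exactly j nonzero functionals, the nonzero differences d are bounded
   away from 0, and a mesh adapted to C keeps the variation of d below |d|.

   Lift the resulting complex to N through f and interpolate g at its vertices.
   For two sheets over a simplex, compare all vertices where they differ with such
   a vertex v0 having the fewest nonzero functionals: |d(v) - d(v0)| < |d(v0)|, so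
   no convex combination of these d(v) vanishes. *)

Require Import Defs.
From mathcomp Require Import all_boot all_order all_algebra finmap.
From mathcomp Require Import all_classical all_reals all_analysis.
From mathcomp Require Import ring lra.
Import numFieldNormedType.Exports.
Import Order.TTheory GRing.Theory Num.Theory.

Set Implicit Arguments.
Unset Strict Implicit.
Unset Printing Implicit Defensive.

Local Open Scope classical_set_scope.
Local Open Scope ring_scope.

(** * Barycentric weights *)

Section Weights.
Variables (R : realType) (V : normedModType R).
Implicit Types (s t : {fset V}) (w : V -> R) (K : {fset {fset V}}).

Definition wsum s w : V := \sum_(v <- s) w v *: v.

(** Vanishing off [s] makes weights on different simplices comparable as functions on all of [V]. *)
Definition weights s w : Prop := barycentric s w /\ forall v, v \notin s -> w v = 0.

Lemma weights_ge0 s w v : weights s w -> 0 <= w v.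
Proof.
move=> [[w0 _] wN]; have [vs|/wN ->//] := boolP (v \in s); exact: w0.
Qed.

Lemma hullP s x : hull s x <-> exists2 w, weights s w & x = wsum s w.
Proof.
split=> [[w [w0 w1] ->]|[w [wb _] ->]]; last by exists w.
exists (fun v => if v \in s then w v else 0).
  split=> [|v /negbTE ->//]; split=> [v vs|]; first by rewrite vs w0.
  by rewrite -w1; apply: eq_big_seq => v vs; rewrite vs.
by apply: eq_big_seq => v vs; rewrite vs.
Qed.

Lemma wsum_sub s t w : fsubset s t -> (forall v, v \notin s -> w v = 0) ->
  wsum t w = wsum s w.
Proof.
move=> st wN; rewrite /wsum -(big_fset_incl _ st) // => v _ vs.
by rewrite wN // scale0r.
Qed.

Lemma sum_sub s t w : fsubset s t -> (forall v, v \notin s -> w v = 0) ->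
  \sum_(v <- t) w v = \sum_(v <- s) w v.
Proof. by move=> st wN; rewrite -(big_fset_incl _ st) // => v _ vs; rewrite wN. Qed.

Lemma weights_sub s t w : fsubset s t -> weights s w -> weights t w.
Proof.
move=> st ws; have [[_ w1] wN] := ws; split.
  by split=> [v _|]; [exact: weights_ge0 ws|rewrite (sum_sub st)].
by move=> v vt; apply: wN; apply: contra vt; exact: (fsubsetP st).
Qed.

Lemma hull_sub s t : fsubset s t -> hull s `<=` hull t.
Proof.
move=> st x /hullP[w ws ->]; apply/hullP; exists w; first exact: weights_sub ws.
by rewrite (wsum_sub st) //; case: ws.
Qed.

Definition supp s w : {fset V} := [fset v in s | w v != 0]%fset.

Lemma supp_sub s w : fsubset (supp s w) s.
Proof. by apply/fsubsetP => v; rewrite !inE => /andP[]. Qed.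

Lemma suppN s w : (forall v, v \notin s -> w v = 0) ->
  forall v, v \notin supp s w -> w v = 0.
Proof.
move=> wN v; rewrite !inE negb_and negbK => /orP[/wN//|/eqP//].
Qed.

Lemma weights_supp s w : weights s w -> weights (supp s w) w.
Proof.
move=> ws; have [[w0 w1] wN] := ws; have sN := suppN wN.
split=> //; split=> [v _|]; first exact: weights_ge0 ws.
by rewrite -w1 (sum_sub (supp_sub s w)).
Qed.

Lemma wsum_supp s w : weights s w -> wsum s w = wsum (supp s w) w.
Proof. by move=> [_ wN]; apply: wsum_sub (supp_sub _ _) (suppN wN). Qed.

Lemma weights_neq0 s w : weights s w -> s != fset0.
Proof.
move=> [[_ w1] _]; apply/eqP => s0; move: w1; rewrite s0 big_seq_fset0.
by move/eqP; rewrite eq_sym oner_eq0.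
Qed.

Lemma hull_vertex s v : v \in s -> hull s v.
Proof.
move=> vs; exists (fun u => (u == v)%:R).
  split=> [u _|]; first by rewrite ler0n.
  rewrite (big_fsetD1 v) //= eqxx big1_seq ?addr0 // => u.
  by rewrite !inE => /andP[_ /andP[/negbTE ->]].
rewrite (big_fsetD1 v) //= eqxx scale1r big1_seq ?addr0 // => u.
by rewrite !inE => /andP[_ /andP[/negbTE -> _]]; rewrite scale0r.
Qed.

(** The weights are kept explicit so that [linear_on_comb] can evaluate a linear map with the same
    ones. *)
Lemma hull_comb (I : eqType) (r : seq I) (p : I -> V) (c : I -> R) s :
  (forall i, i \in r -> 0 <= c i) -> \sum_(i <- r) c i = 1 ->
  (forall i, i \in r -> hull s (p i)) ->
  exists2 d : I -> V -> R, (forall i, i \in r -> weights s (d i) /\ p i = wsum s (d i)) &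
    barycentric s (fun v => \sum_(i <- r) c i * d i v) /\
    \sum_(i <- r) c i *: p i = wsum s (fun v => \sum_(i <- r) c i * d i v).
Proof.
move=> c0 c1 hp.
have /choice [d dP] : forall i, exists w, i \in r -> weights s w /\ p i = wsum s w.
  move=> i; have [/hp/hullP[w ws pw]|_] := boolP (i \in r); first by exists w.
  by exists (fun=> 0).
exists d => //; split.
  split=> [v vs|].
    rewrite big_seq; apply: sumr_ge0 => i ir; rewrite mulr_ge0 ?c0 //.
    by have [/weights_ge0 ->] := dP i ir.
  rewrite exchange_big /= -[RHS]c1; apply: eq_big_seq => i ir.
  by rewrite -mulr_sumr; have [[[_ ->] _] _] := dP i ir; rewrite mulr1.
rewrite /wsum; under [RHS]eq_bigr do rewrite scaler_suml.
rewrite exchange_big /=; apply: eq_big_seq => i ir.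
have [_ {1}->] := dP i ir; rewrite /wsum scaler_sumr.
by apply: eq_bigr => v _; rewrite scalerA.
Qed.

Lemma hull_convex (I : eqType) (r : seq I) (p : I -> V) (c : I -> R) s :
  (forall i, i \in r -> 0 <= c i) -> \sum_(i <- r) c i = 1 ->
  (forall i, i \in r -> hull s (p i)) -> hull s (\sum_(i <- r) c i *: p i).
Proof.
move=> c0 c1 hp; have [d _ [bd e]] := hull_comb c0 c1 hp.
by exists (fun v => \sum_(i <- r) c i * d i v).
Qed.

Lemma hull_hull s t : (forall v, v \in s -> hull t v) -> hull s `<=` hull t.
Proof. by move=> h x [w [w0 w1] ->]; exact: hull_convex. Qed.

Lemma linear_on_comb (W : normedModType R) (f : V -> W) (I : eqType) (r : seq I)
    (p : I -> V) (c : I -> R) s :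
  linear_on s f ->
  (forall i, i \in r -> 0 <= c i) -> \sum_(i <- r) c i = 1 ->
  (forall i, i \in r -> hull s (p i)) ->
  f (\sum_(i <- r) c i *: p i) = \sum_(i <- r) c i *: f (p i).
Proof.
move=> fs c0 c1 hp; have [d dP [bd ->]] := hull_comb c0 c1 hp.
rewrite /wsum fs //; under eq_bigr do rewrite scaler_suml.
rewrite exchange_big /=; apply: eq_big_seq => i ir.
have [[bi _] ->] := dP i ir; rewrite /wsum fs // scaler_sumr.
by apply: eq_bigr => v _; rewrite scalerA.
Qed.

(* Given closure under faces, this single condition is equivalent to affine
   independence of the simplices plus the intersection condition. *)
Definition unique_weights K : Prop := forall s t w w',
  s \in K -> t \in K -> weights s w -> weights t w' -> wsum s w = wsum t w' -> w =1 w'.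

Lemma affinely_independent_unique s w w' : affinely_independent s ->
  weights s w -> weights s w' -> wsum s w = wsum s w' -> w =1 w'.
Proof.
move=> ai [[_ w1] wN] [[_ w1'] wN'] e v.
have [vs|vs] := boolP (v \in s); last by rewrite wN // wN'.
apply/eqP; rewrite -subr_eq0; apply/eqP.
apply: (ai (fun v => w v - w' v)) => //.
  by rewrite sumrB w1 w1' subrr.
under eq_bigr do rewrite scalerBl.
by rewrite sumrB; apply/eqP; rewrite subr_eq0; apply/eqP.
Qed.

(** Adding a small multiple of an affine dependency to the weights of the barycentre changes neither
    the point nor the signs of the weights; uniqueness then forces the dependency to vanish. *)
Lemma unique_affinely_independent s :
  (forall w w', weights s w -> weights s w' -> wsum s w = wsum s w' -> w =1 w') ->
  affinely_independent s.
Proof.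
move=> uw l l0 lv v vs.
pose N := \sum_(v <- s) `|l v|.
have N0 : 0 <= N by apply: sumr_ge0.
have card0 : (0 < #|` s|)%N by rewrite cardfs_gt0; apply/fset0Pn; exists v.
pose c : R := (#|` s|%:R)^-1.
have c0 : 0 < c by rewrite invr_gt0 ltr0n.
(* Since [N] bounds every [|l u|], this factor keeps [c + e * l u] nonnegative; the added 1 covers
   [N = 0]. *)
pose e := c / (N + 1).
have e0 : 0 < e by rewrite divr_gt0 // ltr_wpDl.
pose w u := if u \in s then c else 0.
pose w' u := if u \in s then c + e * l u else 0.
have lN u : u \in s -> `|l u| <= N.
  move=> us; rewrite /N (big_fsetD1 u) //= lerDl; exact: sumr_ge0.
have s1 : \sum_(u <- s) c = 1.
  rewrite big_const_seq count_predT iter_addr_0 /c -[X in X = _]mulr_natl.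
  by rewrite mulfV // pnatr_eq0 -lt0n.
have ww' : w =1 w'.
  apply: uw.
  - split=> [|u /negbTE us]; last by rewrite /w us.
    split=> [u us|]; first by rewrite /w us ltW.
    by rewrite -[RHS]s1; apply: eq_big_seq => u us; rewrite /w us.
  - split=> [|u /negbTE us]; last by rewrite /w' us.
    split=> [u us|].
      rewrite /w' us; have elc : `|- (e * l u)| <= c.
        rewrite normrN normrM gtr0_norm //; apply: (@le_trans _ _ (e * N)).
          by rewrite ler_pM2l // lN.
        by rewrite /e -mulrA ger_pMr // mulrC ler_pdivrMr ?mul1r ?lerDl // ltr_wpDl.
      by have := le_trans (ler_norm _) elc; rewrite lerNl -subr_ge0 opprK addrC.
    have <- : \sum_(u <- s) (c + e * l u) = 1.
      by rewrite big_split /= s1 -mulr_sumr l0 mulr0 addr0.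
    by apply: eq_big_seq => u us; rewrite /w' us.
  - have -> : wsum s w' = \sum_(u <- s) (c *: u + e *: (l u *: u)).
      by apply: eq_big_seq => u us; rewrite /w' us scalerDl scalerA.
    rewrite big_split /= -[X in _ + X]scaler_sumr lv scaler0 addr0.
    by apply: eq_big_seq => u us; rewrite /w us.
have := ww' v; rewrite /w /w' vs => /eqP; rewrite -{1}[c]addr0 (inj_eq (addrI _)).
by rewrite eq_sym mulf_eq0 gt_eqF //= => /eqP.
Qed.

(** A point common to two hulls has weights on the common face, and these agree with its weights in
    each simplex. Conversely, equal weights vanish off both simplices, so they live on the
    intersection. *)
Lemma complexP K : simplicial_complex K <->
  [/\ forall s, s \in K -> s != fset0,
      forall s t, s \in K -> fsubset t s -> t != fset0 -> t \in K & unique_weights K].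
Proof.
split=> [[h1 h2 h3]|[h1 h2 h3]]; split=> //.
- by move=> s /h1[].
- move=> s t w w' sK tK ws wt e.
  have : (hull s `&` hull t) (wsum s w).
    by split; apply/hullP; [exists w|exists w'].
  rewrite h3 // => /hullP[w'' wi e'].
  have [_ wN] := wi.
  have w1 : w =1 w''.
    apply: (affinely_independent_unique (proj2 (h1 _ sK))) => //.
      exact: weights_sub (fsubsetIl s t) wi.
    by rewrite e' (wsum_sub (fsubsetIl s t)).
  have w2 : w' =1 w''.
    apply: (affinely_independent_unique (proj2 (h1 _ tK))) => //.
      exact: weights_sub (fsubsetIr s t) wi.
    by rewrite -e e' (wsum_sub (fsubsetIr s t)).
  by move=> v; rewrite w1 w2.
- by move=> s sK; split; [exact: h1|apply: unique_affinely_independent => w w'; exact: h3].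
- move=> s t sK tK; apply/seteqP; split=> [x [/hullP[w ws e] /hullP[w' wt e']]|x hx].
    have ww : w =1 w' by apply: (h3 s t) => //; rewrite -e.
    have wN : forall v, v \notin fsetI s t -> w v = 0.
      move=> v; rewrite inE negb_and => /orP[]; first by case: ws => _; apply.
      by rewrite ww; case: wt => _; apply.
    apply/hullP; exists w.
      split=> //; split=> [v _|]; first exact: weights_ge0 ws.
      by case: ws => [[_ w1] _]; rewrite -w1 [RHS](sum_sub (fsubsetIl s t)).
    rewrite e (wsum_sub (fsubsetIl s t)) //.
  by split; apply: hull_sub hx; rewrite ?fsubsetIl ?fsubsetIr.
Qed.

End Weights.

(** * Edge bisection *)

(** Here [p] and [q] are two weights of the point dividing an edge, the other variables the
    remaining weights of the endpoints. If [p < q], then [x > z >= 0] and [y > t >= 0], although [x]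
    or [y] is 0; the case [q < p] is symmetric. *)
Lemma cross_coeff (R : realType) (a p q x y z t : R) : 0 < a -> a < 1 ->
  0 <= x -> 0 <= y -> 0 <= z -> 0 <= t -> x = 0 \/ y = 0 -> z = 0 \/ t = 0 ->
  x + p * (1 - a) = z + q * (1 - a) -> y + p * a = t + q * a -> p = q.
Proof.
move=> a0 a1 x0 y0 z0 t0 xy zt e1 e2.
have b0 : 0 < 1 - a by rewrite subr_gt0.
have [pq|pq|//] := ltgtP p q.
- have h1 : p * (1 - a) < q * (1 - a) by rewrite ltr_pM2r.
  have h2 : p * a < q * a by rewrite ltr_pM2r.
  by case: xy => ?; lra.
- have h1 : q * (1 - a) < p * (1 - a) by rewrite ltr_pM2r.
  have h2 : q * a < p * a by rewrite ltr_pM2r.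
  by case: zt => ?; lra.
Qed.

Section Bisection.
Variables (R : realType) (V : normedModType R).
Implicit Types (s t : {fset V}) (w : V -> R) (K : {fset {fset V}}).

Definition space K : set V := [set x | exists2 s, s \in K & hull s x].

Definition verts K : {fset V} := (\bigcup_(s <- K) s)%fset.

Lemma vertsP K v s : s \in K -> v \in s -> v \in verts K.
Proof. by move=> sK vs; apply/bigfcupP; exists s; rewrite ?sK. Qed.

(** This interface hides the construction; later invariants are derived from it alone. *)
Definition bisected K K' (u v m : V) : Prop :=
  [/\ simplicial_complex K', space K' = space K &
    forall t, t \in K' -> (t \in K /\ ~~ fsubset [fset u; v]%fset t) \/
      (m \in t /\ ((t `\ m) `|` [fset u; v])%fset \in K)].

Section Construct.
Variables (K : {fset {fset V}}) (u v : V) (a : R).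
Hypotheses (cK : simplicial_complex K) (uvK : [fset u; v]%fset \in K) (uv : u != v).
Hypotheses (a0 : 0 < a) (a1 : a < 1).

Let m := (1 - a) *: u + a *: v.

(** A simplex containing [m] is a cone with apex [m] over a possibly empty face, omitting [u] or
    [v], of a simplex that contains the edge. *)
Definition bisection : {fset {fset V}} :=
  [fset t in fpowerset (m |` verts K) |
    if m \in t then (((t `\ m) `|` [fset u; v]) \in K) && ~~ ([fset u; v] `<=` t)
    else (t \in K) && ~~ ([fset u; v] `<=` t)]%fset.

(** As a vertex, [m] would have two systems of weights, one at itself and one on the edge; comparing
    them at [u] makes [1 - a] equal to 0 or 1. *)
Lemma midpoint_notin s : s \in K -> m \notin s.
Proof.
move=> sK; apply/negP => ms; have /complexP[_ faces un] := cK.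
have mK : [fset m]%fset \in K.
  apply: (faces s) => //; first by rewrite fsub1set.
  by apply/fset0Pn; exists m; rewrite inE.
pose w (x : V) : R := (1 - a) * (x == u)%:R + a * (x == v)%:R.
pose w' (x : V) : R := (x == m)%:R.
have vu : (v == u) = false by rewrite eq_sym (negbTE uv).
have ww' : w =1 w'.
  apply: (un [fset u; v]%fset [fset m]%fset) => //.
  - split=> [|x]; last first.
      by rewrite !inE negb_or /w => /andP[/negbTE -> /negbTE ->]; rewrite !mulr0 addr0.
    split=> [x _|]; first by rewrite addr_ge0 // mulr_ge0 ?ler0n // ltW // subr_gt0.
    rewrite big_fsetU1 ?inE //= big_seq_fset1 /w !eqxx (negbTE uv) vu /=; ring.
  - split=> [|x]; last by rewrite !inE /w' => /negbTE ->.
    by split=> [x _|]; rewrite /w' ?ler0n // big_seq_fset1 eqxx.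
  - rewrite /wsum big_fsetU1 ?inE //= !big_seq_fset1 /w /w' !eqxx (negbTE uv) vu.
    by rewrite /= !(mulr0, mulr1, addr0, add0r) scale1r.
have := ww' u; rewrite /w /w' eqxx (negbTE uv) mulr0 mulr1 addr0.
by case: (u == m) => /= h; move: a0 a1 => a0' a1'; lra.
Qed.

Lemma endpoint_l_neq : u != m.
Proof.
by apply/eqP => e; have := midpoint_notin uvK; rewrite -e !inE eqxx.
Qed.

Lemma endpoint_r_neq : v != m.
Proof.
by apply/eqP => e; have := midpoint_notin uvK; rewrite -e !inE eqxx orbT.
Qed.

Lemma bisectionP t : t \in bisection <-> ~~ fsubset [fset u; v]%fset t /\
  (t \in K \/ (m \in t /\ ((t `\ m) `|` [fset u; v])%fset \in K)).
Proof.
rewrite !inE; split.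
  by move=> /andP[_]; case: ifP => mt /andP[tK tuv]; split=> //; [right|left].
move=> [tuv h]; apply/andP; split; last first.
  by case: h => [tK|[mt tK]]; rewrite ?mt tuv ?tK //= (negbTE (midpoint_notin tK)).
rewrite fpowersetE; apply/fsubsetP => x xt; rewrite !inE.
case: h => [tK|[mt tK]]; first by rewrite (vertsP tK) ?orbT.
by have [//|xm /=] := eqVneq; apply: (vertsP tK); rewrite !inE xm xt.
Qed.

(* Barycentric weights on the bisected complex, rewritten on the original one
   by redistributing the weight of m to u and v. *)
Definition push w : V -> R := fun x =>
  if x == m then 0 else w x + w m * ((1 - a) * (x == u)%:R + a * (x == v)%:R).

Lemma sum_delta s x (F : V -> R) : x \in s -> \sum_(y <- s) F y * (y == x)%:R = F x.
Proof.
move=> xs; rewrite (big_fsetD1 x) //= eqxx mulr1 big1_seq ?addr0 // => y.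
by rewrite !inE => /andP[_ /andP[/negbTE -> _]]; rewrite mulr0.
Qed.

Lemma wsum_delta s x : x \in s -> wsum s (fun y => (y == x)%:R) = x.
Proof.
move=> xs; rewrite /wsum (big_fsetD1 x) //= eqxx scale1r big1_seq ?addr0 // => y.
by rewrite !inE => /andP[_ /andP[/negbTE -> _]]; rewrite scale0r.
Qed.

Lemma weights_push t w : t \in bisection -> weights t w ->
  exists s, [/\ s \in K, weights s (push w) & wsum s (push w) = wsum t w].
Proof.
move=> /bisectionP[tuv h] wt; have [[_ w1] wN] := wt.
have vu : (v == u) = false by rewrite eq_sym (negbTE uv).
case: h => [tK|[mt tK]].
  have wm : w m = 0 by rewrite wN // midpoint_notin.
  have pw : push w = w.
    by apply/funext => x; rewrite /push wm mul0r addr0; case: eqP => // ->.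
  by exists t; rewrite pw.
set s := (_ `|` _)%fset in tK; have ms := midpoint_notin tK.
have us : u \in s by rewrite !inE eqxx orbT.
have vs : v \in s by rewrite !inE eqxx !orbT.
have ts : fsubset t (m |` s)%fset.
  by apply/fsubsetP => x xt; rewrite !inE xt andbT orbA orbN.
have pE x : x \in s -> push w x = w x + w m * ((1 - a) * (x == u)%:R + a * (x == v)%:R).
  by move=> xs; rewrite /push; case: eqP xs => // ->; rewrite (negbTE ms).
have [w0 wm0] : (forall x, 0 <= w x) /\ 0 <= w m.
  by split=> [x|]; exact: weights_ge0 wt.
exists s; split=> //.
  split; last first.
    move=> x; rewrite /push; case: eqP => // /eqP xm xs.
    move: (xs); rewrite !inE xm /= !negb_or => /and3P[xt /negbTE -> /negbTE ->].
    by rewrite wN // !mulr0 addr0 mulr0 addr0.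
  split=> [x xs|].
    rewrite pE // addr_ge0 // mulr_ge0 // addr_ge0 // mulr_ge0 // ?ler0n //.
      by rewrite subr_ge0 ltW.
    exact: ltW.
  have e1 : w m + \sum_(x <- s) w x = 1 by rewrite -big_fsetU1 //= (sum_sub ts wN).
  rewrite (eq_big_seq _ pE) big_split /= addrC -[RHS]e1; congr (_ + _).
  rewrite -mulr_sumr big_split /= !sum_delta //; ring.
rewrite -(wsum_sub ts wN) /wsum big_fsetU1 //=.
have -> : \sum_(x <- s) push w x *: x = \sum_(x <- s) (w x *: x + w m *:
    ((1 - a) *: ((x == u)%:R *: x) + a *: ((x == v)%:R *: x))).
  apply: eq_big_seq => x xs; by rewrite pE // [LHS]scalerDl -scalerA [X in w m *: X]scalerDl -!scalerA.
rewrite big_split /= addrC; congr (_ + _).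
rewrite -scaler_sumr big_split /= -!scaler_sumr.
by have := wsum_delta us; have := wsum_delta vs; rewrite /wsum => -> ->.
Qed.

(* A simplex of the bisection omits u or v, so the weight of m is recovered as
   the smaller of [push w u / (1 - a)] and [push w v / a]. *)
Lemma push_inj t t' w w' : t \in bisection -> t' \in bisection ->
  weights t w -> weights t' w' -> push w =1 push w' -> w =1 w'.
Proof.
have aux r z : r \in bisection -> weights r z ->
    [/\ z u = 0 \/ z v = 0, forall x, 0 <= z x &
      push z u = z u + z m * (1 - a) /\ push z v = z v + z m * a].
  move=> /bisectionP[ruv _] zr; split.
  - have [ur|ur] := boolP (u \in r); last by left; case: zr => _; apply.
    right; case: zr => _; apply; apply: contra ruv => vr.
    by apply/fsubsetP => x; rewrite !inE => /orP[/eqP ->|/eqP ->].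
  - by move=> x; exact: weights_ge0 zr.
  - rewrite /push (negbTE endpoint_l_neq) (negbTE endpoint_r_neq) !eqxx (negbTE uv).
    by rewrite eq_sym (negbTE uv) /=; split; ring.
move=> tB tB' wt wt' e; have [wuv w0 [pu pv]] := aux _ _ tB wt.
have [wuv' w0' [pu' pv']] := aux _ _ tB' wt'.
have wm : w m = w' m.
  apply: (cross_coeff a0 a1 (w0 u) (w0 v) (w0' u) (w0' v) wuv wuv').
    by rewrite -pu -pu'; exact: e.
  by rewrite -pv -pv'; exact: e.
move=> x; have := e x; rewrite /push; case: eqP => [-> //|_].
by rewrite wm => /addIr.
Qed.

Lemma bisection_unique : unique_weights bisection.
Proof.
move=> t t' w w' tB tB' wt wt' e; have /complexP[_ _ un] := cK.
have [s [sK ws es]] := weights_push tB wt.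
have [s' [sK' ws' es']] := weights_push tB' wt'.
by apply: (push_inj tB tB' wt wt'); apply: (un s s') => //; rewrite es es'.
Qed.

Lemma bisection_complex : simplicial_complex bisection.
Proof.
have /complexP[ne faces _] := cK.
apply/complexP; split; last exact: bisection_unique.
  move=> t /bisectionP[_ [/ne//|[mt _]]].
  by apply/fset0Pn; exists m.
move=> t r /bisectionP[tuv h] rt r0; apply/bisectionP; split.
  by apply: contra tuv => /fsubset_trans; apply.
case: h => [tK|[mt tK]]; first by left; exact: faces tK rt r0.
have [mr|mr] := boolP (m \in r); [right; split=> //|left]; apply: faces tK _ _ => //.
- apply/fsubsetP => x; rewrite !inE => /orP[/andP[-> /(fsubsetP rt) ->]//|->].
  by rewrite orbT.
- by apply/fset0Pn; exists u; rewrite !inE eqxx orbT.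
- apply/fsubsetP => x xr; rewrite !inE (fsubsetP rt x xr) andbT.
  by case: eqP xr mr => [->->|].
Qed.

Lemma midpoint_hull : hull [fset u; v]%fset m.
Proof.
have := @hull_convex _ V _ [:: true; false] (fun b => if b then u else v)
  (fun b => if b then 1 - a else a) [fset u; v]%fset.
rewrite !big_cons !big_nil /= !addr0; apply=> [||i _].
- by case=> _; rewrite ?subr_ge0 ltW.
- by rewrite subrK.
- by apply: hull_vertex; case: i; rewrite !inE eqxx ?orbT.
Qed.

End Construct.

Lemma bisected_hull K K' u v m t : hull [fset u; v]%fset m -> bisected K K' u v m ->
  t \in K' -> t \in K \/ [/\ m \in t, (t `\ m `|` [fset u; v])%fset \in K &
  hull t `<=` hull (t `\ m `|` [fset u; v])%fset].
Proof.
move=> mh [_ _ h] /h[[tK _]|[mt tK]]; [by left|right; split=> //].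
apply: hull_hull => x xt; have [->|xm] := eqVneq x m.
  by apply: hull_sub mh; exact: fsubsetUr.
by apply: hull_vertex; rewrite !inE xm xt.
Qed.

(** The inequality says that [m] can absorb all the weight of [u] without exhausting that of [v], so
    the point lies in the half that omits [u]. The other half follows by exchanging the endpoints
    with [bisectionC]. *)
Lemma bisection_cover K u v a : simplicial_complex K -> [fset u; v]%fset \in K ->
  u != v -> 0 < a -> a < 1 -> forall s w, s \in K -> weights s w ->
  fsubset [fset u; v]%fset s -> w u * a <= w v * (1 - a) ->
  space (bisection K u v a) (wsum s w).
Proof.
move=> cK uvK uv a0 a1 s w sK ws uvs le.
set m := (1 - a) *: u + a *: v.
have us : u \in s by apply: (fsubsetP uvs); rewrite !inE eqxx.
have vs : v \in s by apply: (fsubsetP uvs); rewrite !inE eqxx orbT.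
have ms : m \notin s by exact: (midpoint_notin cK uvK uv a0 a1 sK).
have b0 : 0 < 1 - a by rewrite subr_gt0.
exists (m |` (s `\ u))%fset.
  apply/bisectionP => //; split.
    apply/negP => /fsubsetP /(_ u); rewrite !inE !eqxx /= orbF => /(_ isT) /eqP e.
    by move: ms; rewrite -e us.
  rewrite -/m; right; rewrite !inE eqxx; split=> //.
  suff -> : (((m |` s `\ u) `\ m) `|` [fset u; v] = s)%fset by [].
  apply/fsetP => x; rewrite !inE.
  have [->|xu] /= := eqVneq x u; first by rewrite orbT us.
  have [->|xv] /= := eqVneq x v; first by rewrite orbT vs.
  by rewrite orbF; have [->|//] := eqVneq x m; rewrite (negbTE ms).
have [[_ w1] _] := ws; have w0 x := weights_ge0 x ws.
(* The weight of [m] is chosen so that its share at [u] is exactly [w u]. *)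
pose p := w u / (1 - a).
have p0 : 0 <= p by rewrite divr_ge0 // ltW.
have pu : p * (1 - a) = w u by rewrite /p divfK // gt_eqF.
have pv : p * a <= w v by rewrite -(ler_pM2r b0) mulrAC pu.
pose z x := if x == m then p else if x == v then w v - p * a else w x.
have vsu : v \in (s `\ u)%fset by rewrite !inE vs eq_sym uv.
have msu : m \notin (s `\ u)%fset by rewrite !inE negb_and ms orbT.
have zm : z m = p by rewrite /z eqxx.
have zv : z v = w v - p * a.
  by rewrite /z eqxx; case: eqP vs => // ->; rewrite (negbTE ms).
have zx x : x \in (s `\ u `\ v)%fset -> z x = w x.
  rewrite !inE => /and3P[/negbTE xv _ xs]; rewrite /z xv.
  by case: eqP xs => // ->; rewrite (negbTE ms).
exists z.
  split=> [x _|].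
    by rewrite /z; case: ifP => // _; case: ifP => // _; rewrite subr_ge0.
  rewrite big_fsetU1 //= (big_fsetD1 v) //= (eq_big_seq _ zx) -w1.
  rewrite (big_fsetD1 u us) (big_fsetD1 v vsu) /= zm zv -pu; ring.
rewrite /wsum [RHS]big_fsetU1 //= [X in _ = _ + X](big_fsetD1 v) //= zm zv.
rewrite (big_fsetD1 u us) (big_fsetD1 v vsu) /= -pu.
have -> : \sum_(x <- (s `\ u `\ v)%fset) z x *: x =
          \sum_(x <- (s `\ u `\ v)%fset) w x *: x.
  by apply: eq_big_seq => x xs; rewrite zx.
rewrite !addrA; congr (_ + _); rewrite /m scalerDr !scalerA -addrA; congr (_ + _).
by rewrite scalerBl addrC subrK.
Qed.

Lemma bisectionC K u v a : bisection K v u (1 - a) = bisection K u v a.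
Proof.
rewrite /bisection subKr [_ *: v + _]addrC.
by rewrite [[fset v; u]%fset]fsetUC.
Qed.

Lemma bisectionK K u v a : simplicial_complex K -> [fset u; v]%fset \in K ->
  u != v -> 0 < a -> a < 1 ->
  bisected K (bisection K u v a) u v ((1 - a) *: u + a *: v).
Proof.
move=> cK uvK uv a0 a1; split; first exact: bisection_complex.
  apply/seteqP; split=> [x [t tB /hullP[w wt ->]]|x [s sK /hullP[w ws ->]]].
    have [s [sK ws <-]] := weights_push cK uvK uv a0 a1 tB wt.
    by exists s => //; apply/hullP; exists (push u v a w).
  have [uvs|uvs] := boolP (fsubset [fset u; v]%fset s); last first.
    exists s; last by apply/hullP; exists w.
    by apply/bisectionP => //; split=> //; left.
  have [le|lt] := leP (w u * a) (w v * (1 - a)); first exact: bisection_cover.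
  rewrite -bisectionC; apply: bisection_cover => //.
  - by rewrite fsetUC.
  - by rewrite eq_sym.
  - by rewrite subr_gt0.
  - by rewrite ltrBlDr ltrDl.
  - by rewrite fsetUC.
  - by rewrite subKr ltW.
by move=> t /bisectionP => /(_ cK uvK uv a0 a1)[tuv [tK|]]; [left|right].
Qed.

(** The number of bad edges drops at each bisection: the divided edge disappears and, by the last
    condition, no edge at the new vertex is bad. *)
Lemma bisect_eliminate (bad : V -> V -> Prop) (Inv : {fset {fset V}} -> Prop) :
  (forall x y, bad x y -> x != y) ->
  (forall K, Inv K -> simplicial_complex K) ->
  (forall K u v, Inv K -> [fset u; v]%fset \in K -> bad u v -> exists a,
    let m := (1 - a) *: u + a *: v in
    [/\ 0 < a, a < 1,
        forall K', hull [fset u; v]%fset m -> bisected K K' u v m -> Inv K' &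
        forall y, (y |` [fset u; v])%fset \in K -> ~ bad m y /\ ~ bad y m]) ->
  forall K, Inv K -> exists2 K', Inv K' &
    forall u v, [fset u; v]%fset \in K' -> ~ bad u v.
Proof.
move=> badN cInv step K.
pose B K := [fset s in K | `[< exists x y, s = [fset x; y]%fset /\ bad x y >]]%fset.
have [n] := ubnP #|` B K|; elim: n => // n IHn in K * => leB iK.
have [[u [v [uvK buv]]]|no] := pselect (exists u v, [fset u; v]%fset \in K /\ bad u v);
  last by exists K => // u v uvK buv; apply: no; exists u, v.
have uv := badN _ _ buv; have cK := cInv _ iK.
have [a [a0 a1 hI hbad]] := step _ _ _ iK uvK buv.
have bK := bisectionK cK uvK uv a0 a1.
apply: (IHn (bisection K u v a)); last exact: hI (midpoint_hull _ _ a0 a1) bK.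
move: leB; rewrite ltnS; apply: leq_trans.
apply: fproper_ltn_card; apply: (@fsub_proper_trans _ (B K `\ [fset u; v]%fset)%fset); last first.
  by apply: fproperD1; rewrite !inE uvK /=; apply/asboolP; exists u, v.
apply/fsubsetP => t; rewrite !inE => /andP[tB /asboolP[x [y [te bxy]]]].
have [_ _ /(_ t) h] := bK.
have {h}[|[tK tuv]|[mt]] := h; first by rewrite !inE.
  rewrite tK; case: eqP tuv => [->|_ _]; first by rewrite fsubset_refl.
  by apply/asboolP; exists x, y.
have xy := badN _ _ bxy.
set m := _ + _ in mt hbad *; rewrite te; move: mt; rewrite te !inE => /orP[] /eqP em.
  have -> : ([fset x; y] `\ m)%fset = [fset y]%fset.
    apply/fsetP => z; rewrite !inE em; have [->|] := eqVneq z x => //=.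
    by rewrite (negbTE xy).
  by move=> /hbad[]; rewrite em.
have -> : ([fset x; y] `\ m)%fset = [fset x]%fset.
  apply/fsetP => z; rewrite !inE em; have [->|] := eqVneq z y => //=.
    by rewrite eq_sym (negbTE xy).
  by rewrite orbF.
by move=> /hbad[]; rewrite em.
Qed.

End Bisection.

(** * Continuity of PL maps *)

Section Topology.
Variables (R : realType) (V : normedModType R).
Implicit Types (s t : {fset V}) (K : {fset {fset V}}).

Lemma continuous_bigsum (T : topologicalType) (I : Type) (r : seq I) (F : I -> T -> V) :
  (forall i, continuous (F i)) -> continuous (fun x => \sum_(i <- r) F i x).
Proof.
move=> cF x; elim: r => [|i r IH].
  by under eq_fun do rewrite big_nil; exact: cst_continuous.
by under eq_fun do rewrite big_cons; apply: cvgD => //; exact: cF.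
Qed.

Definition std_simplex r : set 'rV[R]_r :=
  [set w | (forall i, 0 <= w 0 i) /\ \sum_i w 0 i = 1].

Definition affine_comb r (p : 'I_r -> V) (w : 'rV[R]_r) : V := \sum_i w 0 i *: p i.

Lemma affine_comb_continuous r (p : 'I_r -> V) : continuous (affine_comb p).
Proof.
apply: continuous_bigsum => i w.
apply: (@continuous_comp _ _ _ (fun w : 'rV[R]_r => w 0 i) (fun c => c *: p i)).
  exact: coord_continuous.
exact: scalel_continuous.
Qed.
End Topology.

Arguments std_simplex : clear implicits.

Lemma std_simplex_compact (R : realType) r : compact (std_simplex R r).
Proof.
apply: bounded_closed_compact.
  exists 1; split=> [|M M1 w [w0 w1]]; first exact: real1.
  rewrite /= [leLHS]/Num.norm /= mx_normrE; apply/bigmax_leP; split=> [|[i j] _ /=].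
    by rewrite ltW // (lt_trans _ M1).
  rewrite ord1 ger0_norm // (le_trans _ (ltW M1)) // -w1 (bigD1 j) //= lerDl.
  by apply: sumr_ge0 => *.
have -> : std_simplex R r = \bigcap_i [set w : 'rV[R]_r | 0 <= w 0 i] `&`
    [set w | \sum_i w 0 i = 1].
  by apply/seteqP; split=> w [h1 h2]; split=> //; [move=> i _|move=> i]; exact: h1.
apply: closedI; first apply: closed_bigI => i _.
  apply: (@preimage_closed _ _ (fun w : 'rV[R]_r => w 0 i) [set y | 0 <= y]).
    by move=> ? _; exact: coord_continuous.
  exact: closed_ge.
apply: (@preimage_closed _ _ (fun w : 'rV[R]_r => \sum_i w 0 i) [set y | y = 1]).
  by move=> ? _; apply: (@continuous_bigsum R R) => i; exact: coord_continuous.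
exact: closed_eq.
Qed.

Section Hulls.
Variables (R : realType) (V : normedModType R).
Implicit Types (s t : {fset V}) (K : {fset {fset V}}).

Lemma hull_param s :
  hull s = affine_comb (fun i : 'I_(size s) => nth 0 s i) @` std_simplex R (size s).
Proof.
apply/seteqP; split=> [x [w [w0 w1] ->]|x [w [w0 w1] <-]].
  exists (\row_i w (nth 0 s i)).
    split=> [i|]; first by rewrite mxE w0 // mem_nth.
    by rewrite -w1 (big_nth 0) big_mkord; apply: eq_bigr => i _; rewrite mxE.
  by rewrite /affine_comb (big_nth 0) big_mkord; apply: eq_bigr => i _; rewrite mxE.
apply: hull_convex => // i _; apply: hull_vertex.
by apply: (mem_nth 0).
Qed.

Lemma hull_compact s : compact (hull s).
Proof.
rewrite hull_param; apply: continuous_compact; last exact: std_simplex_compact.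
by apply: continuous_subspaceT; exact: affine_comb_continuous.
Qed.

Lemma hull_closed s : closed (hull s).
Proof. by apply: compact_closed; [exact: norm_hausdorff|exact: hull_compact]. Qed.

Lemma linear_on_continuous (W : normedModType R) s (f : V -> W) :
  linear_on s f -> {within hull s, continuous f}.
Proof.
move=> fs; apply/continuous_closedP => C cC; apply/closed_subspaceP.
exists (hull s `&` f @^-1` C); last by rewrite setIAC setIid setIC.
have -> : hull s `&` f @^-1` C = affine_comb (fun i : 'I_(size s) => nth 0 s i) @`
    (std_simplex R (size s) `&` affine_comb (fun i : 'I_(size s) => f (nth 0 s i)) @^-1` C).
  rewrite hull_param; have e w : std_simplex R (size s) w ->
      f (affine_comb (fun i : 'I_(size s) => nth 0 s i) w) =
      affine_comb (fun i : 'I_(size s) => f (nth 0 s i)) w.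
    move=> [w0 w1]; apply: (linear_on_comb fs) => // i _.
    by apply: hull_vertex; apply: (mem_nth 0).
  apply/seteqP; split=> [x [[w sw <-]]|x [w [sw cw] <-]] /=.
    by rewrite e // => cw; exists w.
  by split; [exists w|rewrite e].
apply: compact_closed; first exact: norm_hausdorff.
apply: continuous_compact.
  by apply: continuous_subspaceT; exact: affine_comb_continuous.
apply: (subclosed_compact _ (@std_simplex_compact R (size s))); last exact: subIsetl.
apply: closedI; first by apply: compact_closed; [exact: norm_hausdorff|exact: std_simplex_compact].
by apply: preimage_closed => // ? _; exact: affine_comb_continuous.
Qed.

Lemma finite_union_compact (P : {fset V} -> Prop) (r : seq {fset V}) :
  compact [set x | exists t, [/\ t \in r, P t & hull t x]].
Proof.
elim: r => [|s r IH].
  rewrite (_ : [set _ | _] = set0); first exact: compact0.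
  by apply/seteqP; split=> x // [t []].
have -> : [set x | exists t, [/\ t \in s :: r, P t & hull t x]] =
    [set x | P s /\ hull s x] `|` [set x | exists t, [/\ t \in r, P t & hull t x]].
  apply/seteqP; split=> [x [t [tr pt ht]]|x [[ps hs]|[t [tr pt ht]]]].
  - move: tr; rewrite inE => /orP[/eqP e|tr]; first by left; rewrite -e.
    by right; exists t.
  - by exists s; rewrite inE eqxx.
  - by exists t; rewrite inE tr orbT.
apply: compactU => //; have [ps|nps] := pselect (P s).
  rewrite (_ : [set _ | _] = hull s); first exact: hull_compact.
  by apply/seteqP; split=> x // [].
rewrite (_ : [set _ | _] = set0); first exact: compact0.
by apply/seteqP; split=> x // [].
Qed.

Lemma space_compact K : compact (space K).
Proof.
have := @finite_union_compact (fun=> True) K; congr compact.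
by apply/seteqP; split=> [x [t [tK _ ht]]|x [t tK ht]]; exists t.
Qed.

Lemma linear_space_continuous (W : normedModType R) K (f : V -> W) :
  (forall s, s \in K -> linear_on s f) -> {within space K, continuous f}.
Proof.
move=> fK; pose U (r : seq {fset V}) := [set x | exists t, [/\ t \in r, True & hull t x]].
suff h (r : seq {fset V}) : (forall s, s \in r -> linear_on s f) -> {within U r, continuous f}.
  have <- : U K = space K; last exact: h.
  by apply/seteqP; split=> [x [t [tK _ ht]]|x [t tK ht]]; exists t.
elim: r => [_|s r IH fr].
  have -> : U [::] = set0 by apply/seteqP; split=> x // [t []].
  exact: continuous_subspace0.
have -> : U (s :: r) = hull s `|` U r.
  apply/seteqP; split=> [x [t [tr _ ht]]|x [hs|[t [tr _ ht]]]].
  - move: tr; rewrite inE => /orP[/eqP e|tr]; first by left; rewrite -e.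
    by right; exists t.
  - by exists s; rewrite inE eqxx.
  - by exists t; rewrite inE tr orbT.
apply: withinU_continuous; [exact: hull_closed| | |].
- by apply: compact_closed; [exact: norm_hausdorff|exact: finite_union_compact].
- by apply: linear_on_continuous; apply: fr; rewrite inE eqxx.
- by apply: IH => t tr; apply: fr; rewrite inE tr orbT.
Qed.

Lemma PL_map_topological (W : normedModType R) (X : set V) (Y : set W) f :
  PL_map X Y f -> topological_map X Y f.
Proof.
move=> [fXY [K [_ XK] fK]]; split=> //.
by rewrite XK; exact: linear_space_continuous.
Qed.

End Hulls.

Lemma PL_embedding_topological (R : realType) (V W : normedModType R)
  (X : set V) (Y : set W) F : PL_embedding X Y F -> topological_embedding X Y F.
Proof.
move=> [PF [G PG GF]]; split; first exact: PL_map_topological.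
by exists G => //; exact: PL_map_topological.
Qed.

(** * Complexes subordinate to an arrangement *)

Section Arrangement.
Variables (R : realType) (V : normedModType R).
Implicit Types (s t : {fset V}) (K : {fset {fset V}}) (h : V -> R).

Definition affine_fun h : Prop := forall (I : eqType) (r : seq I) (p : I -> V) (c : I -> R),
  \sum_(i <- r) c i = 1 -> h (\sum_(i <- r) c i *: p i) = \sum_(i <- r) c i * h (p i).

Lemma affine_fun2 h u v a : affine_fun h ->
  h ((1 - a) *: u + a *: v) = (1 - a) * h u + a * h v.
Proof.
move=> ah; have := ah _ [:: true; false] (fun b => if b then u else v)
  (fun b => if b then 1 - a else a).
by rewrite !big_cons !big_nil /= !addr0; apply; rewrite subrK.
Qed.

(** Reduces claims about new edges to the possibly degenerate triangle spanned in [K] by the old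
    endpoint and the divided edge. *)
Lemma bisected_edge K K' u v m x y : bisected K K' u v m -> x != y ->
  [fset x; y]%fset \in K' -> [\/ [fset x; y]%fset \in K,
    x = m /\ (y |` [fset u; v])%fset \in K | y = m /\ (x |` [fset u; v])%fset \in K].
Proof.
move=> [_ _ B] xy /B[[xyK _]|[mxy]]; first by constructor 1.
move: mxy; rewrite !inE => /orP[] /eqP em.
  have -> : ([fset x; y] `\ m)%fset = [fset y]%fset.
    apply/fsetP => z; rewrite !inE em; have [->|] := eqVneq z x => //=.
    by rewrite (negbTE xy).
  by constructor 2.
have -> : ([fset x; y] `\ m)%fset = [fset x]%fset.
  apply/fsetP => z; rewrite !inE em; have [->|] := eqVneq z y => //=.
    by rewrite eq_sym (negbTE xy).
  by rewrite orbF.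
by constructor 3.
Qed.

Lemma edge_face K t x y : simplicial_complex K -> t \in K -> x \in t -> y \in t ->
  [fset x; y]%fset \in K.
Proof.
move=> /complexP[_ faces _] tK xt yt; apply: faces tK _ _.
  by apply/fsubsetP => z; rewrite !inE => /orP[] /eqP ->.
by apply/fset0Pn; exists x; rewrite !inE eqxx.
Qed.

Section Functionals.
Variable H : seq (V -> R).
Hypothesis aH : forall h, h \in H -> affine_fun h.

(** Testing edges is enough to keep whole simplices on one side of each [h], since any two vertices
    of a simplex of a complex span an edge. *)
Definition nocross K : Prop := forall h, h \in H -> forall u v,
  [fset u; v]%fset \in K -> ~ (h u < 0 /\ 0 < h v).

(** The value at the new vertex is a convex combination of those at [u] and [v]. Both span edges of
    [K] with the other endpoint, so neither has the sign opposite to the value there. *)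
Lemma nocross_bisect K K' u v a : simplicial_complex K -> 0 < a -> a < 1 ->
  bisected K K' u v ((1 - a) *: u + a *: v) -> nocross K -> nocross K'.
Proof.
move=> cK a0 a1 B nK h hH x y xyK' [hx hy].
have b0 : 0 < 1 - a by rewrite subr_gt0.
have xy : x != y.
  by apply/eqP => e; rewrite e in hx; have := lt_trans hx hy; rewrite ltxx.
have hm := affine_fun2 u v a (aH hH).
have [xyK|[ex K1]|[ey K1]] := bisected_edge B xy xyK'.
- by apply: (nK h hH x y).
- have [e1 e2] : [fset u; y]%fset \in K /\ [fset v; y]%fset \in K.
    by split; apply: (edge_face cK K1); rewrite !inE eqxx ?orbT.
  have hu : 0 <= h u by rewrite leNgt; apply/negP => hu; apply: (nK h hH u y).
  have hv : 0 <= h v by rewrite leNgt; apply/negP => hv; apply: (nK h hH v y).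
  by move: hx; rewrite ltNge ex hm addr_ge0 // mulr_ge0 // ltW.
- have [e1 e2] : [fset x; u]%fset \in K /\ [fset x; v]%fset \in K.
    by split; apply: (edge_face cK K1); rewrite !inE eqxx ?orbT.
  have hu : h u <= 0 by rewrite leNgt; apply/negP => hu; apply: (nK h hH x u).
  have hv : h v <= 0 by rewrite leNgt; apply/negP => hv; apply: (nK h hH x v).
  have p1 := mulr_ge0_le0 (ltW b0) hu; have p2 := mulr_ge0_le0 (ltW a0) hv.
  by move: hy; rewrite ltNge ey hm -[X in _ <= X]addr0 lerD.
Qed.

(* z lies in the closure of the cell of y in the arrangement H. *)
Definition zle (z y : V) : Prop := forall h, h \in H ->
  (0 <= h y -> 0 <= h z) /\ (h y <= 0 -> h z <= 0).

(** Grades the cells of the arrangement: the count drops on passing to a proper face of a cell, by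
    [zle_nz] and [zle_nz_eq]. *)
Definition nz (y : V) : nat := count (fun h => h y != 0) H.

Lemma zle_neq0 z y h : h \in H -> zle z y -> h z != 0 -> h y != 0.
Proof.
move=> hH /(_ h hH)[z1 z2]; apply: contra => /eqP hy.
by rewrite eq_le z1 ?z2 ?hy.
Qed.

Lemma zle_nz z y : zle z y -> (nz z <= nz y)%N.
Proof.
move=> zy; rewrite /nz (@eq_in_count _ _ (fun h => (h z != 0) && (h y != 0))).
  by apply: sub_count => h /andP[].
by move=> h hH /=; case: eqP => //= /eqP /(zle_neq0 hH zy) ->.
Qed.

(** The functionals nonzero at [z] form a sublist of those nonzero at [y]. The counts force
    equality, so no nonzero sign is lost in the closure. *)
Lemma zle_nz_eq z y : zle z y -> (nz y <= nz z)%N -> zle y z.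
Proof.
move=> zy le h hH; have [z1 z2] := zy h hH.
have hh : h y != 0 -> h z != 0.
  have : all (fun h => (h y != 0) ==> (h z != 0)) H; last by move=> /allP/(_ h hH)/implyP.
  have sub : [seq h <- H | h z != 0] = [seq h <- [seq h <- H | h y != 0] | h z != 0].
    rewrite -filter_predI; apply: eq_in_filter => g gH /=.
    by case: eqP => //= /eqP /(zle_neq0 gH zy) ->.
  apply/allP => g gH; apply/implyP => gy.
  have : g \in [seq h <- H | h y != 0] by rewrite mem_filter gy.
  have e : size [seq h <- [seq h <- H | h y != 0] | h z != 0] = size [seq h <- H | h y != 0].
    apply/eqP; rewrite -sub eqn_leq !size_filter le andbT.
    exact: zle_nz.
  have : all (fun h => h z != 0) [seq h <- H | h y != 0].
    by rewrite all_count -size_filter e eqxx.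
  by move=> /allP; apply.
split=> hz.
  rewrite leNgt; apply/negP => hy; have := hh (ltr0_neq0 hy).
  by rewrite eq_le hz z2 // ltW.
rewrite leNgt; apply/negP => hy; have := hh (lt0r_neq0 hy).
by rewrite eq_le hz z1 // ltW.
Qed.

(** If [h v < 0], then [h] is positive at no vertex of [t], and the positive weight of [v] makes [h]
    negative at the point; likewise with the signs reversed. *)
Lemma zle_vertex K t w v : simplicial_complex K -> nocross K -> t \in K ->
  weights t w -> w v != 0 -> zle v (wsum t w).
Proof.
move=> cK nK tK wt wv h hH.
have vt : v \in t by apply: contraNT wv; case: wt => _ /(_ v) wN /wN ->.
have [[w0 w1] _] := wt; have wv0 : 0 < w v by rewrite lt_def wv (weights_ge0 v wt).
rewrite /wsum (aH hH) //; rewrite (big_fsetD1 v vt) /=.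
split=> hy; rewrite leNgt; apply/negP => hv; move: hy; apply/negP; rewrite -ltNge.
  apply: ltr_wnDr; last by rewrite pmulr_rlt0.
  rewrite big_seq; apply: sumr_le0 => x; rewrite !inE => /andP[_ xt].
  rewrite mulr_ge0_le0 //; first exact: w0.
  rewrite leNgt; apply/negP => hx; apply: (nK h hH v x) => //.
  exact: edge_face cK tK vt xt.
apply: ltr_wpDr; last by rewrite pmulr_rgt0.
rewrite big_seq; apply: sumr_ge0 => x; rewrite !inE => /andP[_ xt].
rewrite mulr_ge0 //; first exact: w0.
rewrite leNgt; apply/negP => hx; apply: (nK h hH x v) => //.
exact: edge_face cK tK xt vt.
Qed.

Lemma nz_hull j K t y : simplicial_complex K -> nocross K -> t \in K ->
  (forall v, v \in t -> (j <= nz v)%N) -> hull t y -> (j <= nz y)%N.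
Proof.
move=> cK nK tK tj /hullP[w wt ->].
have /fset0Pn[v] := weights_neq0 (weights_supp wt).
rewrite !inE => /andP[vt wv]; apply: leq_trans (tj v vt) _; apply: zle_nz.
exact: zle_vertex cK nK tK wt wv.
Qed.

End Functionals.

(** The functionals are treated one at a time; [nocross_bisect] protects the earlier ones. *)
Lemma nocross_ex H K : (forall h, h \in H -> affine_fun h) -> simplicial_complex K ->
  exists K', [/\ simplicial_complex K', space K' = space K & nocross H K'].
Proof.
move=> aH cK; elim: H aH => [|h H IH] aH; first by exists K.
have aH' : forall g, g \in H -> affine_fun g by move=> g gH; apply: aH; rewrite inE gH orbT.
have ah : affine_fun h by apply: aH; rewrite inE eqxx.
have {IH}[K1 [cK1 sK1 nK1]] := IH aH'.
pose Inv K' := [/\ simplicial_complex K', space K' = space K & nocross H K'].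
pose bad x y := h x < 0 /\ 0 < h y.
have [||K' u v [cK' sK' nK'] uvK' [hu hv]||K2 [cK2 sK2 nK2] nb] :=
    @bisect_eliminate _ _ bad Inv _ _ _ K1.
- move=> x y [hx hy]; apply/eqP => e; rewrite e in hx.
  by have := lt_trans hx hy; rewrite ltxx.
- by move=> ? [].
- have d0 : 0 < h v - h u by rewrite subr_gt0 (lt_trans hu).
  have vu : 0 < - h u by rewrite oppr_gt0.
  (* The edge is divided at the zero of [h], so no edge ending at the new vertex crosses. *)
  exists (- h u / (h v - h u)); set a := _ / _ => m.
  have a0 : 0 < a by rewrite divr_gt0.
  have a1 : a < 1 by rewrite ltr_pdivrMr // mul1r ltrDr.
  have hm : h m = 0.
    by rewrite affine_fun2 // /a; field; rewrite gt_eqF.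
  split=> // [K3 _ B|y _]; last by rewrite /bad hm; split=> -[]; rewrite ltxx.
  have [cK3 sK3 _] := B; split=> //; first by rewrite sK3.
  exact: nocross_bisect B nK'.
- by [].
- exists K2; split=> // g; rewrite inE => /orP[/eqP -> x y xyK2|]; last exact: nK2.
  exact: nb.
Qed.

End Arrangement.

(** * Graded subdivision *)

Section Mesh.
Variables (R : realType) (n : nat).
Local Notation V := 'rV[R]_n.
Implicit Types (s t : {fset V}) (K : {fset {fset V}}) (x y u v : V).

(** The Euclidean norm squared is preferred to the maximum norm because the median identity
    [sqn_mid] supplies the gain that shrinks edges. *)
Definition sqn x : R := \sum_i x 0 i ^+ 2.

Lemma sqn_ge0 x : 0 <= sqn x.
Proof. by apply: sumr_ge0 => i _; exact: sqr_ge0. Qed.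

Lemma sqn0 : sqn 0 = 0.
Proof. by rewrite /sqn big1 // => i _; rewrite mxE expr0n. Qed.

Lemma sqn_eq0 x : sqn x = 0 -> x = 0.
Proof.
move=> x0; apply/rowP => i; rewrite mxE; apply/eqP; rewrite -sqrf_eq0.
move: x0 => /eqP; rewrite psumr_eq0 => [/allP/(_ i)|j _]; last exact: sqr_ge0.
by apply; rewrite mem_index_enum.
Qed.

Lemma sqnN x : sqn (- x) = sqn x.
Proof. by apply: eq_bigr => i _; rewrite mxE sqrrN. Qed.

Lemma sqn_mid u v y : sqn ((1 - 2^-1) *: u + 2^-1 *: v - y) =
  2^-1 * sqn (u - y) + 2^-1 * sqn (v - y) - 4^-1 * sqn (u - v).
Proof.
rewrite /sqn !mulr_sumr -big_split -sumrB /=; apply: eq_bigr => i _.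
by rewrite !mxE; field.
Qed.

Lemma sqn_continuous : continuous sqn.
Proof.
apply: (@continuous_bigsum R R) => i x.
apply: (@continuous_comp _ _ _ (fun w : V => w 0 i) (fun c => c ^+ 2)).
  exact: coord_continuous.
exact: exprn_continuous.
Qed.

Variable H : seq (V -> R).
Hypothesis aH : forall h, h \in H -> affine_fun h.
Local Notation off j y := (j <= nz H y)%N.

Definition inside_off (j : nat) (C : set V) K : Prop :=
  forall t, t \in K -> (forall v, v \in t -> off j v) -> hull t `<=` C.

(** The state reached by stage [j], shaped so that it survives the bisections of later stages. *)
Definition fine_off (j : nat) (mu : R) (C : set V) K : Prop :=
  [/\ 0 < mu,
      forall x y, [fset x; y]%fset \in K -> off j x -> off j y -> sqn (x - y) < mu &
      inside_off j C K].

Lemma inside_off_bisect j J C K K' u v m : (j <= J)%N -> off J u -> off J v ->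
  hull [fset u; v]%fset m -> bisected K K' u v m -> inside_off j C K -> inside_off j C K'.
Proof.
move=> jJ ou ov mh B ins t tK' ot.
have [tK|[mt tK sub]] := bisected_hull mh B tK'; first exact: ins.
apply: subset_trans sub _; apply: ins => // x.
rewrite !inE => /orP[/andP[_ /ot]//|/orP[]/eqP ->]; exact: leq_trans jJ _.
Qed.

Lemma half_itv : 0 < 2^-1 :> R /\ 2^-1 < 1 :> R.
Proof. split; lra. Qed.

Lemma edge_bisect K K' u v x y : simplicial_complex K ->
  bisected K K' u v ((1 - 2^-1) *: u + 2^-1 *: v) -> x != y ->
  [fset x; y]%fset \in K' -> [fset x; y]%fset \in K \/
  exists z, [/\ z = x \/ z = y, [fset u; z]%fset \in K, [fset v; z]%fset \in K &
    sqn (x - y) = 2^-1 * sqn (u - z) + 2^-1 * sqn (v - z) - 4^-1 * sqn (u - v)].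
Proof.
move=> cK B xy xyK'; have [xyK|[ex K1]|[ey K1]] := bisected_edge B xy xyK'; first by left.
- right; exists y; rewrite -sqn_mid -ex; split=> //; [by right| |];
  by apply: (edge_face cK K1); rewrite !inE eqxx ?orbT.
- right; exists x; rewrite -sqn_mid -ey -(sqnN (y - x)) opprB; split=> //; [by left| |];
  by apply: (edge_face cK K1); rewrite !inE eqxx ?orbT.
Qed.

(** A new edge is a median of a triangle in which the two sides from the same vertex are already
    short, and a median is no longer than the longer of these. *)
Lemma fine_off_bisect j J mu C K K' u v : simplicial_complex K -> (j <= J)%N ->
  off J u -> off J v -> hull [fset u; v]%fset ((1 - 2^-1) *: u + 2^-1 *: v) ->
  bisected K K' u v ((1 - 2^-1) *: u + 2^-1 *: v) -> fine_off j mu C K -> fine_off j mu C K'.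
Proof.
move=> cK jJ ou ov mh B [mu0 short ins]; split=> //; last first.
  exact: inside_off_bisect jJ ou ov mh B ins.
have ou' := leq_trans jJ ou; have ov' := leq_trans jJ ov.
move=> x y xyK' ox oy; have [->|xy] := eqVneq x y; first by rewrite subrr sqn0.
have [xyK|[z [zxy uzK vzK ->]]] := edge_bisect cK B xy xyK'; first exact: short.
have oz : off j z by case: zxy => ->.
have h1 := short _ _ uzK ou' oz; have h2 := short _ _ vzK ov' oz.
have h3 := sqn_ge0 (u - v); clear -h1 h2 h3; lra.
Qed.

(* If all edges have squared length at most l, bisecting one longer than 4l/5
   creates only edges shorter than l - (4l/5)/4 = 4l/5. *)
Lemma mesh_shrink J (Q : {fset {fset V}} -> Prop) mu : 0 < mu ->
  (forall K, Q K -> simplicial_complex K) ->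
  (forall K K' u v, Q K -> off J u -> off J v ->
    hull [fset u; v]%fset ((1 - 2^-1) *: u + 2^-1 *: v) ->
    bisected K K' u v ((1 - 2^-1) *: u + 2^-1 *: v) -> Q K') ->
  forall K, Q K -> exists2 K', Q K' & forall x y, [fset x; y]%fset \in K' ->
    off J x -> off J y -> sqn (x - y) < mu.
Proof.
move=> mu0 cQ bQ K QK.
pose short l K' := forall x y, [fset x; y]%fset \in K' -> off J x -> off J y -> sqn (x - y) <= l.
have step l K1 : 0 <= l -> Q K1 -> short l K1 -> exists2 K2, Q K2 & short (l * (4 / 5)) K2.
  move=> l0 QK1 sK1.
  pose bad x y := [/\ x != y, off J x, off J y & l * (4 / 5) < sqn (x - y)].
  have [||K' u v [QK' sK'] uvK' [uv ou ov big]||K2 [QK2 _] nb] :=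
    @bisect_eliminate _ _ bad (fun K => Q K /\ short l K) _ _ _ K1.
  - by move=> x y [].
  - by move=> K' [/cQ].
  - have [h0 h1] := half_itv; exists 2^-1 => m.
    have mE : m = (1 - 2^-1) *: u + 2^-1 *: v by [].
    split=> //.
      move=> K3 mh B; split; first exact: bQ B.
      move=> x y xyK3 ox oy; have [->|xy] := eqVneq x y; first by rewrite subrr sqn0.
      have [xyK|[z [zxy uzK vzK ->]]] := edge_bisect (cQ _ QK') B xy xyK3; first exact: sK'.
      have oz : off J z by case: zxy => ->.
      have e1 := sK' _ _ uzK ou oz; have e2 := sK' _ _ vzK ov oz.
      have e3 := sqn_ge0 (u - v); clear -e1 e2 e3; lra.
    move=> y yuvK.
    have [e1 e2] : [fset u; y]%fset \in K' /\ [fset v; y]%fset \in K'.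
      by split; apply: (edge_face (cQ _ QK') yuvK); rewrite !inE eqxx ?orbT.
    have ub : off J y -> sqn (m - y) <= l * (4 / 5).
      move=> oy; rewrite mE sqn_mid; have s1 := sK' _ _ e1 ou oy; have s2 := sK' _ _ e2 ov oy.
      by clear -s1 s2 big; lra.
    split=> -[_ o1 o2]; apply/negP; rewrite -leNgt; first exact: ub.
    by rewrite -sqnN opprB; exact: ub.
  - by [].
  exists K2 => // x y xyK2 ox oy; have [->|xy] := eqVneq x y.
    by rewrite subrr sqn0 mulr_ge0.
  by rewrite leNgt; apply/negP => lt; apply: (nb x y).
pose l := \sum_(x <- verts K) \sum_(y <- verts K) sqn (x - y).
have l0 : 0 <= l by apply: sumr_ge0 => x _; apply: sumr_ge0 => y _; exact: sqn_ge0.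
have sK : short l K.
  move=> x y xyK _ _.
  have xK : x \in verts K by apply: vertsP xyK _; rewrite !inE eqxx.
  have yK : y \in verts K by apply: vertsP xyK _; rewrite !inE eqxx orbT.
  rewrite /l (big_fsetD1 x xK) /= (big_fsetD1 y yK) /= -addrA lerDl addr_ge0 //.
    by apply: sumr_ge0 => z _; exact: sqn_ge0.
  by apply: sumr_ge0 => z _; apply: sumr_ge0 => z' _; exact: sqn_ge0.
have iter k : exists2 K', Q K' & short (l * (4 / 5) ^+ k) K'.
  elim: k => [|k [K' QK' sK']]; first by exists K; rewrite ?expr0 ?mulr1.
  have lk : 0 <= l * (4 / 5) ^+ k by rewrite mulr_ge0 // exprn_ge0.
  by have [K2 QK2 sK2] := step _ _ lk QK' sK'; exists K2 => //; rewrite exprSr [_ * (_ ^+ k * _)]mulrA.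
have [k lk] : exists k, l * (4 / 5) ^+ k < mu.
  have z1 : `|4 / 5 : R| < 1 by rewrite ger0_norm //; lra.
  have := @cvg_geometric R l _ z1 => /cvgrPdist_lt/(_ _ mu0)[k _ hk].
  exists k; have := hk k (leqnn k); rewrite sub0r normrN /geometric /=.
  by apply: le_lt_trans; exact: ler_norm.
have [K' QK' sK'] := iter k; exists K' => // x y xyK' ox oy.
exact: le_lt_trans (sK' _ _ xyK' ox oy) lk.
Qed.

(** [good] stands for the separation requirement. Since [mu] depends on [C], each stage first reads
    [C] off the complex left by the previous one, then refines by bisections that do not enlarge
    that region. *)
Lemma graded_subdivision (good : nat -> R -> set V -> Prop) K :
  simplicial_complex K ->
  (forall j C, compact C -> (forall y, C y -> off j y) -> exists2 mu, 0 < mu & good j mu C) ->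
  exists K', [/\ simplicial_complex K', space K' = space K, nocross H K' &
    forall j, (j <= size H)%N -> exists mu C, good j mu C /\ fine_off j mu C K'].
Proof.
move=> cK hgood; have [K0 [cK0 sK0 nK0]] := nocross_ex aH cK.
suff [K' [cK' sK' nK' gK']] : exists K', [/\ simplicial_complex K', space K' = space K,
    nocross H K' & forall j, (j < (size H).+1)%N -> exists mu C, good j mu C /\ fine_off j mu C K'].
  by exists K'; split.
(* One stage for each possible value of [nz], from 0 to [size H]. *)
elim: (size H).+1 => [|J [K1 [cK1 sK1 nK1 gK1]]]; first by exists K0.
have /choice[g gP] : forall j, exists p : R * set V, (j < J)%N ->
    good j p.1 p.2 /\ fine_off j p.1 p.2 K1.
  move=> j; case: (boolP (j < J)%N) => [/gK1[mu [C h]]|_]; first by exists (mu, C).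
  by exists (0, set0).
(* By [nz_hull] the lower bound [J] holds at all points of these simplices, not only at their
   vertices. *)
pose C := [set x | exists t, [/\ t \in K1, forall v, v \in t -> off J v & hull t x]].
have cC : compact C by exact: finite_union_compact.
have offC y : C y -> off J y.
  by move=> [t [tK ot hty]]; apply: (nz_hull aH cK1 nK1 tK).
have [mu mu0 gmu] := hgood J C cC offC.
pose Q K' := [/\ simplicial_complex K', space K' = space K, nocross H K',
  inside_off J C K' & forall j, (j < J)%N -> fine_off j (g j).1 (g j).2 K'].
have [|||K2 [cK2 sK2 nK2 iK2 fK2] sh] := @mesh_shrink J Q mu mu0 _ _ K1.
- by move=> K' [].
- move=> K' K'' u v [cK' sK' nK' iK' fK'] ou ov mh B; have [cK'' sK'' _] := B.
  have [h0 h1] := half_itv.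
  split=> //.
  + by rewrite sK''.
  + exact: nocross_bisect h0 h1 B nK'.
  + exact: inside_off_bisect (leqnn J) ou ov mh B iK'.
  + by move=> j jJ; apply: fine_off_bisect (ltnW jJ) ou ov mh B (fK' j jJ).
- split=> //; last by move=> j /gP[].
  by move=> t tK1 ot x hx; exists t.
exists K2; split=> // j; rewrite ltnS leq_eqVlt => /orP[/eqP ->|jJ].
  by exists mu, C; split.
by exists (g j).1, (g j).2; split; [have [] := gP j jJ|exact: fK2].
Qed.

End Mesh.

(** * Simplices as unions of cells *)

Section Functionals.
Variables (R : realType) (m : nat).
Local Notation V := 'rV[R]_m.
Implicit Types (s t : {fset V}) (K : {fset {fset V}}) (x y u v : V).

Definition aff_coord p (X : 'M[R]_(m, p)) (b : 'rV[R]_p) (j : 'I_p) y : R :=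
  (y *m X + b) 0 j.

Lemma aff_coord_affine p (X : 'M[R]_(m, p)) b j : affine_fun (aff_coord X b j).
Proof.
move=> I r q c c1; rewrite /aff_coord mxE mulmx_suml summxE.
under [RHS]eq_bigr do rewrite mxE mulrDr.
rewrite big_split /= -mulr_suml c1 mul1r; congr (_ + _).
by apply: eq_bigr => i _; rewrite -scalemxAl mxE.
Qed.

Lemma aff_coord_continuous p (X : 'M[R]_(m, p)) b j : continuous (aff_coord X b j).
Proof.
have -> : aff_coord X b j = (fun y => \sum_k y 0 k * X k j) \+ cst (b 0 j).
  by apply/funext => y; rewrite /aff_coord !mxE.
move=> y; apply: continuousD; last exact: cst_continuous.
apply: (@continuous_bigsum R R) => k z.
apply: (@continuous_comp _ _ _ (fun w : V => w 0 k) (fun c => c * X k j)).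
  exact: coord_continuous.
exact: mulrr_continuous.
Qed.

(** Homogeneous coordinates turn affine independence into linear independence of the rows. *)
Definition vertex_mx s : 'M[R]_(size s, m + 1) :=
  \matrix_i row_mx (nth 0 (s : seq V) i) 1.

Lemma vertex_mx_mul s (w : 'rV[R]_(size s)) :
  w *m vertex_mx s = row_mx (\sum_i w 0 i *: nth 0 (s : seq V) i) (\sum_i w 0 i)%:M.
Proof.
rewrite mulmx_sum_row; apply/rowP => j; rewrite summxE.
case: (split_ordP j) => k ->.
  by rewrite row_mxEl summxE; apply: eq_bigr => i _; rewrite rowK !mxE (unsplitK (inl _)).
rewrite row_mxEr ord1 !mxE eqxx mulr1n; apply: eq_bigr => i _.
by rewrite rowK !mxE (unsplitK (inr _)) mxE eqxx mulr1.
Qed.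

Lemma vertex_mx_free s : affinely_independent s -> row_free (vertex_mx s).
Proof.
move=> ai; apply: inj_row_free => w wM.
have : w *m vertex_mx s = row_mx 0 0 by rewrite row_mx0.
rewrite vertex_mx_mul => /eq_row_mx[e1 /matrixP/(_ 0 0)]; rewrite !mxE eqxx mulr1n => e2.
pose l x : R := \sum_(i < size s) w 0 i * (x == nth 0 (s : seq V) i)%:R.
have lE (i : 'I_(size s)) : l (nth 0 (s : seq V) i) = w 0 i.
  rewrite /l (bigD1 i) //= eqxx mulr1 big1 ?addr0 // => j ji.
  have -> : (nth 0 (s : seq V) i == nth 0 (s : seq V) j) = false; last by rewrite mulr0.
  by rewrite nth_uniq ?fset_uniq ?ltn_ord //; apply/negbTE; rewrite eq_sym.
apply/rowP => i; rewrite mxE -lE; apply: ai; last exact: mem_nth.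
- by rewrite (big_nth 0) big_mkord -[RHS]e2; apply: eq_bigr => j _; rewrite lE.
- by rewrite (big_nth 0) big_mkord -[RHS]e1; apply: eq_bigr => j _; rewrite lE.
Qed.

Lemma affinely_independent_card s : affinely_independent s -> (#|` s| <= m.+1)%N.
Proof.
move=> /vertex_mx_free /eqP e; have := rank_leq_col (vertex_mx s).
by rewrite e addn1.
Qed.

(* The functionals are barycentric coordinates extended to the whole space,
   together with the defects of the resulting affine decomposition. *)
Lemma hull_functionals s : affinely_independent s -> exists H : seq (V -> R),
  [/\ forall h, h \in H -> affine_fun h, forall h, h \in H -> continuous h &
    forall y z, hull s y -> zle H z y -> hull s z].
Proof.
move=> /vertex_mx_free /row_freeP[B MB].
pose X := usubmx B; pose b := dsubmx B.
have BE : B = col_mx X b by rewrite vsubmxK.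
(* [hom y *m C] vanishes exactly when [hom y] is recovered from its coordinates [hom y *m B]; these
   entries are the defects. *)
pose C : 'M[R]_(m + 1, m + 1) := 1%:M - B *m vertex_mx s.
pose Y := usubmx C; pose d := dsubmx C.
have CE : C = col_mx Y d by rewrite vsubmxK.
pose hom y : 'rV[R]_(m + 1) := row_mx y 1.
have hB y : y *m X + b = hom y *m B by rewrite /hom BE mul_row_col mul1mx.
have hC y : y *m Y + d = hom y *m C by rewrite /hom CE mul_row_col mul1mx.
exists ([seq aff_coord X b i | i <- enum 'I_(size s)] ++
        [seq aff_coord Y d i | i <- enum 'I_(m + 1)]).
split.
- by move=> h; rewrite mem_cat => /orP[] /mapP[i _ ->]; exact: aff_coord_affine.
- by move=> h; rewrite mem_cat => /orP[] /mapP[i _ ->]; exact: aff_coord_continuous.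
move=> y z; rewrite hull_param => -[w [w0 w1] <-] zy.
set y0 := affine_comb _ w in zy.
have hy : hom y0 = w *m vertex_mx s by rewrite vertex_mx_mul w1.
have yB : hom y0 *m B = w by rewrite hy -mulmxA MB mulmx1.
have yC : hom y0 *m C = 0 by rewrite mulmxBr mulmx1 mulmxA yB hy subrr.
(* The defects are 0 at [y0], so the two halves of [zle] make them 0 at [z]; for the coordinates
   only nonnegativity is transferred. *)
have zC : hom z *m C = 0.
  apply/rowP => j; have := zy (aff_coord Y d j); rewrite mem_cat map_f ?mem_enum ?orbT //.
  move=> /(_ isT); rewrite /aff_coord !hC yC !mxE lexx => -[/(_ isT) z1 /(_ isT) z2].
  by apply/eqP; rewrite eq_le z1 z2.
have zB i : 0 <= (hom z *m B) 0 i.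
  have := zy (aff_coord X b i); rewrite mem_cat map_f ?mem_enum //.
  by move=> /(_ isT); rewrite /aff_coord !hB yB => -[/(_ (w0 i))].
have : hom z = hom z *m B *m vertex_mx s.
  by apply/eqP; rewrite -subr_eq0 -mulmxA -[X in X - _]mulmx1 -mulmxBr zC.
rewrite vertex_mx_mul => /eq_row_mx[ez /matrixP/(_ 0 0)]; rewrite !mxE eqxx mulr1n => e1.
by exists (hom z *m B).
Qed.

Definition faces_of s : {fset {fset V}} := (fpowerset s `\ fset0)%fset.

Lemma faces_ofP s t : t \in faces_of s <-> t != fset0 /\ fsubset t s.
Proof. by rewrite !inE fpowersetE; split=> [/andP[]|[-> ->]]. Qed.

Lemma faces_of_complex s : affinely_independent s -> simplicial_complex (faces_of s).
Proof.
move=> ai; apply/complexP; split.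
- by move=> t /faces_ofP[].
- by move=> t r /faces_ofP[_ ts] rt r0; apply/faces_ofP; split=> //; exact: fsubset_trans ts.
move=> t r w w' /faces_ofP[_ ts] /faces_ofP[_ rs] wt wr e.
apply: (affinely_independent_unique ai); [exact: weights_sub wt|exact: weights_sub wr|].
by rewrite (wsum_sub ts) ?(wsum_sub rs) //; [case: wr|case: wt].
Qed.

(** The simplex has a corner at the lowest vertex of a cube containing [X] and equal edges along the
    coordinate axes. *)
Lemma big_simplex_ex (X : set V) : compact X -> exists K, simplicial_complex K /\ X `<=` space K.
Proof.
move=> cX; have [B [_ hB]] := compact_bounded cX.
pose M := `|B| + 1; have M0 : 0 < M by rewrite ltr_wpDl.
have XM x i : X x -> `|x 0 i| <= M.
  move=> Xx; apply: le_trans (hB M _ x Xx).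
    rewrite [leRHS]/Num.norm /= mx_normrE; apply/bigmax_geP; right => /=.
    by exists (0, i).
  by rewrite /M; apply: le_lt_trans (ler_norm B) _; rewrite ltrDl.
(* Coordinates measured from the corner are at most [M * 2], so after division by [L] each is at
   most the inverse of [m.+1] and their sum is at most 1. *)
pose L := M * 2 * m.+1%:R; have L0 : 0 < L by rewrite !mulr_gt0 // ltr0n.
pose v0 : V := const_mx (- M).
pose v (i : 'I_m) : V := v0 + L *: delta_mx 0 i.
pose S : {fset V} := (v0 |` [fset v i | i in 'I_m])%fset.
have vS i : v i \in S.
  by rewrite !inE; apply/orP; right; apply/imfsetP; exists i.
have v0S : v0 \in S by rewrite !inE eqxx.
have vE i j : (v i - v0) 0 j = L * (i == j)%:R.
  by rewrite /v addrAC subrr add0r !mxE eqxx /= eq_sym.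
have SP x : x \in S -> x = v0 \/ exists i, x = v i.
  rewrite !inE => /orP[/eqP ->|/imfsetP[i _ ->]]; [by left|by right; exists i].
exists (faces_of S); split.
  apply: faces_of_complex => l l0 lv.
  have li i : l (v i) = 0.
    have : \sum_(x <- S) l x *: (x - v0) = 0.
      under eq_bigr do rewrite scalerBr.
      by rewrite sumrB lv -scaler_suml l0 scale0r subrr.
    move=> /rowP/(_ i); rewrite summxE (big_fsetD1 (v i)) //= big1_seq ?addr0.
      rewrite mxE vE eqxx mulr1 mxE => /eqP; rewrite mulf_eq0 (gt_eqF L0) orbF.
      by move/eqP.
    move=> x; rewrite !inE => /andP[_ /andP[xv]] xS.
    have /SP[->|[j ej]] : x \in S by rewrite !inE.
      by rewrite subrr scaler0 mxE.
    rewrite ej mxE vE; case: eqP => [eji|]; last by rewrite !mulr0.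
    by move: xv; rewrite ej eji eqxx.
  move=> x /SP[->|[i ->]] //; move: l0; rewrite (big_fsetD1 v0) //= big1_seq ?addr0 //.
  move=> y; rewrite !inE => /andP[_ /andP[yv yS]].
  have /SP[ey|[j ->]//] : y \in S by rewrite !inE.
  by rewrite ey eqxx in yv.
move=> x Xx; exists S; first by apply/faces_ofP; split=> //; apply/fset0Pn; exists v0.
pose c i := (x 0 i + M) / L.
have c0 i : 0 <= c i.
  rewrite divr_ge0 ?(ltW L0) //; have := XM x i Xx; rewrite ler_norml => /andP[h _].
  by rewrite -lerBlDr sub0r.
have c1 : \sum_i c i <= 1.
  apply: (@le_trans _ _ (\sum_(i < m) (m.+1%:R)^-1)).
    apply: ler_sum => i _; rewrite /c ler_pdivrMr // /L mulrC mulfK ?pnatr_eq0 //.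
    have := XM x i Xx; rewrite ler_norml => /andP[_ h].
    by rewrite mulr_natr mulr2n lerD2r.
  rewrite sumr_const card_ord -[X in X *+ _]mul1r -mulrnAr -mulr_natl mul1r.
  by rewrite ler_pdivrMr ?ltr0n // mul1r ler_nat.
pose p (i : 'I_m.+1) := if unlift ord0 i is Some j then v j else v0.
pose d (i : 'I_m.+1) := if unlift ord0 i is Some j then c j else 1 - \sum_j c j.
have -> : x = \sum_i d i *: p i.
  rewrite big_ord_recl.
  have -> : \sum_(i < m) d (lift ord0 i) *: p (lift ord0 i) =
      \sum_(i < m) (c i *: v0 + c i *: (L *: delta_mx 0 i)).
    by apply: eq_bigr => i _; rewrite /d /p liftK scalerDr.
  rewrite /d /p unlift_none.
  apply/rowP => j; rewrite big_split /= mxE [X in _ + X]mxE !summxE.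
  have -> : \sum_(i < m) (c i *: v0) 0 j = (\sum_i c i) * - M.
    by rewrite mulr_suml; apply: eq_bigr => i _; rewrite !mxE.
  have -> : \sum_(i < m) (c i *: (L *: delta_mx 0 i : V)) 0 j = x 0 j + M.
    rewrite (bigD1 j) //= big1 ?addr0.
      by rewrite !mxE !eqxx mulr1 divfK ?gt_eqF.
    by move=> i ij; rewrite !mxE eq_sym (negbTE ij) andbF !mulr0.
  rewrite !mxE; ring.
apply: hull_convex => [i _||i _].
- by rewrite /d; case: unliftP => // _; rewrite subr_ge0.
- rewrite big_ord_recl.
  have -> : \sum_(i < m) d (lift ord0 i) = \sum_(i < m) c i.
    by apply: eq_bigr => i _; rewrite /d liftK.
  by rewrite /d unlift_none subrK.
- by rewrite /p; case: unliftP => [j _|_]; apply: hull_vertex.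
Qed.

(** Two points of a simplex with the same value span a segment inside a fibre. As [has_dimension]
    asks for a largest simplex, one is chosen using the bound on the size of affinely independent
    sets. *)
Lemma nondegenerate_injective (W : normedModType R) (N : set V) (f : V -> W) K :
  non_degenerate N f -> triangulates K N -> (forall s, s \in K -> linear_on s f) ->
  forall s x y, s \in K -> hull s x -> hull s y -> f x = f y -> x = y.
Proof.
move=> nd [cK NK] fK s x y sK hx hy fxy; apply/eqP; apply/negPn/negP => xy; apply: nd.
pose X := N `&` f @^-1` [set f x].
pose P c := `[< exists t : {fset V}, [/\ is_simplex t, #|` t| = c & hull t `<=` X] >].
have P2 : P 2%N.
  apply/asboolP; exists [fset x; y]%fset; split.
  - split; first by apply/fset0Pn; exists x; rewrite !inE eqxx.
    move=> l; rewrite !big_fsetU1 ?inE //= !big_seq_fset1 => l0 lv.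
    have ly : l y = - l x by apply/eqP; rewrite -addr_eq0 addrC l0.
    have lx : l x = 0.
      move: lv; rewrite ly scaleNr -scalerBr => /eqP; rewrite scaler_eq0 subr_eq0 (negbTE xy).
      by rewrite orbF => /eqP.
    by move=> z; rewrite !inE => /orP[]/eqP ->; rewrite ?ly lx ?oppr0.
  - by rewrite cardfs2 xy.
  - move=> z [w [w0 w1] ->].
    have hxy v : v \in [fset x; y]%fset -> hull s v by rewrite !inE => /orP[]/eqP ->.
    split; first by rewrite NK; exists s => //; exact: hull_convex.
    rewrite /= (linear_on_comb (fK s sK)) // -[RHS]scale1r -w1 scaler_suml.
    by apply: eq_big_seq => v; rewrite !inE => /orP[]/eqP ->; rewrite ?fxy.
have Pb c : P c -> (c <= m.+1)%N.
  by move=> /asboolP[t [[_ ai] <- _]]; exact: affinely_independent_card.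
have exP : exists c, P c by exists 2%N.
case: (ex_maxnP exP Pb) => c Pc cmax.
have c2 := cmax _ P2.
exists (f x), c.-1; split; first by rewrite -ltnS prednK // (leq_trans _ c2).
have cc : c.-1.+1 = c by rewrite prednK // (leq_trans _ c2).
split; first by rewrite cc; move: Pc => /asboolP.
by move=> t st tX; rewrite cc; apply: cmax; apply/asboolP; exists t.
Qed.

End Functionals.

(** * Linear images and extensions *)

Section Images.
Variables (R : realType) (A B : normedModType R).
Implicit Types (t : {fset A}) (K : {fset {fset A}}).

(** Pulling weights back along an injection of vertices transfers uniqueness of weights to image
    simplices; the last clause recovers [w] from [c]. *)
Lemma imfset_weights (p : A -> B) t w : {in t &, injective p} ->
  weights (p @` t)%fset w ->
  exists2 c : A -> R, weights t c & [/\ forall v, v \in t -> c v = w (p v),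
    wsum (p @` t)%fset w = \sum_(v <- t) c v *: p v &
    forall y, w y != 0 -> exists2 v, v \in t & y = p v /\ c v = w y].
Proof.
move=> pinj wp; have [[w0 w1] wN] := wp.
exists (fun v => if v \in t then w (p v) else 0).
  split=> [|v /negbTE ->//]; split=> [v vt|].
    by rewrite vt (weights_ge0 _ wp).
  rewrite -[RHS]w1 [RHS]big_imfset //=.
  by apply: eq_big_seq => v vt; rewrite vt.
split=> [v -> //||y wy].
  rewrite /wsum [LHS]big_imfset //=; apply: eq_big_seq => v vt; by rewrite vt.
have /imfsetP[v vt e] : y \in (p @` t)%fset by apply: contraNT wy => /wN ->.
by exists v => //; rewrite vt e.
Qed.

Lemma image_hull t (f : A -> B) y : linear_on t f ->
  hull (f @` t)%fset y <-> exists2 x, hull t x & f x = y.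
Proof.
move=> ft; split=> [hy|[x [w [w0 w1] ->] <-]]; last first.
  by rewrite ft //; apply: hull_convex => // v vt; apply: hull_vertex; exact: in_imfset.
have /choice[p pP] : forall z, exists v, z \in (f @` t)%fset -> hull t v /\ f v = z.
  move=> z; have [/imfsetP[v vt ->]|] := boolP (z \in (f @` t)%fset).
    by exists v => _; split=> //; exact: hull_vertex.
  by exists 0.
have [w [w0 w1] ->] := hy.
exists (\sum_(z <- (f @` t)%fset) w z *: p z).
  by apply: hull_convex => // z /pP[].
rewrite (linear_on_comb ft) //; last by move=> z /pP[].
by apply: eq_big_seq => z /pP[_ ->].
Qed.

Lemma image_independent t (f : A -> B) : affinely_independent t -> linear_on t f ->
  (forall x y, hull t x -> hull t y -> f x = f y -> x = y) ->
  affinely_independent (f @` t)%fset.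
Proof.
move=> ai ft finj.
have fi : {in t &, injective f}.
  by move=> x y xt yt; apply: finj; exact: hull_vertex.
apply: unique_affinely_independent => w w' ww ww' e.
have [c tc [cE ec cw]] := imfset_weights fi ww.
have [c' tc' [cE' ec' cw']] := imfset_weights fi ww'.
have fc d : weights t d -> f (wsum t d) = \sum_(v <- t) d v *: f v by move=> [bd _]; exact: ft.
have cc : c =1 c'.
  apply: (affinely_independent_unique ai tc tc'); apply: finj;
    [by apply/hullP; exists c|by apply/hullP; exists c'|].
  by rewrite !fc // -ec -ec'.
move=> y; have [yt|yt] := boolP (y \in (f @` t)%fset); last first.
  by have [_ ->] := ww => //; have [_ ->] := ww'.
by have /imfsetP[v vt ->] := yt; rewrite -cE // -cE'.
Qed.

(** By injectivity on the whole space, a point shared by two image simplices has a single preimage,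
    so the pulled-back weights agree, and with them the original ones. *)
Lemma complex_image K (F : A -> B) : simplicial_complex K ->
  (forall s, s \in K -> linear_on s F) ->
  (forall x y, space K x -> space K y -> F x = F y -> x = y) ->
  exists K' : {fset {fset B}}, [/\ triangulates K' (F @` space K) &
    forall r, r \in K' -> exists2 s, s \in K & r = (F @` s)%fset].
Proof.
move=> cK FK Finj; have /complexP[ne faces un] := cK.
have Fi s : s \in K -> {in s &, injective F}.
  by move=> sK x y xs ys; apply: Finj; exists s => //; exact: hull_vertex.
pose K' : {fset {fset B}} := ((fun s : {fset A} => (F @` s)%fset) @` K)%fset.
have K'P r : r \in K' -> exists2 s, s \in K & r = (F @` s)%fset.
  by move=> /imfsetP[s sK ->]; exists s.
exists K'; split=> //; split.
  apply/complexP; split.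
  - move=> r /K'P[s sK ->]; have /fset0Pn[v vs] := ne s sK.
    by apply/fset0Pn; exists (F v); exact: in_imfset.
  - move=> r r' /K'P[s sK ->] sub r0.
    have e : r' = (F @` [fset v in s | F v \in r'])%fset.
      apply/fsetP => y; apply/idP/imfsetP => /= [yr|[v]].
        have /imfsetP[v vs ev] := fsubsetP sub y yr.
        by exists v => //; rewrite !inE vs -ev.
      by rewrite !inE => /andP[_ vr] ->.
    apply/imfsetP; exists [fset v in s | F v \in r']%fset => //=.
    apply: faces sK _ _; first by apply/fsubsetP => v; rewrite !inE => /andP[].
    have /fset0Pn[y yr] := r0; have /imfsetP[v /= vs ev] := fsubsetP sub y yr.
    by apply/fset0Pn; exists v; rewrite !inE vs -ev.
  - move=> r r' w w' /K'P[s sK ->] /K'P[t tK ->] ww ww' e.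
    have [c tc [cE ec cw]] := imfset_weights (Fi s sK) ww.
    have [c' tc' [cE' ec' cw']] := imfset_weights (Fi t tK) ww'.
    have fc q d : q \in K -> weights q d -> F (wsum q d) = \sum_(v <- q) d v *: F v.
      by move=> qK [bd _]; exact: FK.
    have cc : c =1 c'.
      apply: (un s t) => //; apply: Finj; [exists s|exists t|] => //;
        [by apply/hullP; exists c|by apply/hullP; exists c'|].
      by rewrite !fc // -ec -ec'.
    have aux (z z' : B -> R) (d d' : A -> R) (q q' : {fset A}) :
        (forall v, v \in q' -> d' v = z' (F v)) ->
        weights q' d' -> (forall y, z y != 0 -> exists2 v, v \in q & y = F v /\ d v = z y) ->
        d =1 d' -> forall y, z y != 0 -> z y = z' y.
      move=> hd' [_ dN] hz dd y zy; have [v _ [ey ev]] := hz y zy.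
      have vq : v \in q' by apply: contraNT zy => /dN; rewrite -ev dd => ->.
      by rewrite -ev dd hd' // ey.
    move=> y; have [wy|wy] := eqVneq (w y) 0; last exact: (aux w w' c c' s t cE' tc' cw cc).
    have [w'y|w'y] := eqVneq (w' y) 0; first by rewrite wy.
    by apply/esym; apply: (aux w' w c' c t s cE tc cw') => // v; rewrite cc.
apply/seteqP; split=> [y [x [s sK hx] <-]|y [r /K'P[s sK ->] /image_hull-/(_ (FK s sK))[x hx <-]]].
  exists (F @` s)%fset; first by apply/imfsetP; exists s.
  by apply/image_hull; [exact: FK|exists x].
by exists x => //; exists s.
Qed.

(** The inverse is linear on the image of each simplex, so the image complex triangulates its domain
    suitably; off the image its values are arbitrary. *)
Lemma PL_embedding_of_injective K X (Y : set B) (F : A -> B) : triangulates K X ->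
  (forall s, s \in K -> linear_on s F) -> F @` X `<=` Y ->
  (forall x y, X x -> X y -> F x = F y -> x = y) -> PL_embedding X Y F.
Proof.
move=> tK FK FXY Finj; have [cK XK] := tK.
split; first by split=> //; exists K.
have [G GP] : exists G : B -> A, forall x, X x -> G (F x) = x.
  have /choice[G GP] : forall y, exists x, (F @` X) y -> X x /\ F x = y.
    move=> y; have [[x Xx <-]|] := pselect ((F @` X) y); first by exists x.
    by exists 0.
  exists G => x Xx; have [|XG FG] := GP (F x); first by exists x.
  exact: Finj.
exists G => //; split; first by move=> _ [_ [x Xx <-] <-]; rewrite GP.
have Finj' x y : space K x -> space K y -> F x = F y -> x = y by move: Finj; rewrite XK; exact.
have [K' [tK' K'P]] := complex_image cK FK Finj'.
exists K'; first by rewrite XK.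
move=> r /K'P[s sK ->] w bw.
have hX z : hull s z -> X z by move=> hz; rewrite XK; exists s.
have Fi : {in s &, injective F}.
  by move=> x y xs ys; apply: Finj; apply: hX; exact: hull_vertex.
have bs : barycentric s (fun v => w (F v)).
  have [w0 w1] := bw; split=> [v vs|]; first by rewrite w0 // in_imfset.
  by rewrite -[RHS]w1 [RHS]big_imfset.
rewrite ![\sum_(v <- (F @` s)%fset) _]big_imfset //= -(FK s sK) // GP.
  by apply: eq_big_seq => v vs; rewrite GP //; apply: hX; exact: hull_vertex.
by apply: hX; exists (fun v => w (F v)).
Qed.

(** The value at a point is computed in any simplex containing it. Two choices give the same sum
    over the union of the simplices, by uniqueness of weights. *)
Lemma linear_extension K (phi : A -> B) : simplicial_complex K ->
  exists g : A -> B, (forall s, s \in K -> linear_on s g) /\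
    forall s v, s \in K -> v \in s -> g v = phi v.
Proof.
move=> /complexP[_ _ un].
have /choice[g gP] : forall x, exists y, forall s w, s \in K -> weights s w ->
    x = wsum s w -> y = \sum_(v <- s) w v *: phi v.
  move=> x.
  have [[s [w [sK ws xE]]]|no] := pselect (exists s w, [/\ s \in K, weights s w & x = wsum s w]);
    last by exists 0 => s w sK ws xE; exfalso; apply: no; exists s, w.
  exists (\sum_(v <- s) w v *: phi v) => t w' tK wt xE'.
  have ww' : w =1 w' by apply: (un s t) => //; rewrite -xE.
  have [_ wN] := ws; have [_ wN'] := wt.
  transitivity (\sum_(v <- (s `|` t)%fset) w v *: phi v).
    by apply: big_fset_incl; [exact: fsubsetUl|move=> v _ vs; rewrite wN // scale0r].
  under eq_bigr do rewrite ww'; apply/esym.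
  by apply: big_fset_incl; [exact: fsubsetUr|move=> v _ vs; rewrite wN' // scale0r].
have gv s v : s \in K -> v \in s -> g v = phi v.
  move=> sK vs; pose w x : R := (x == v)%:R.
  have bw : weights s w.
    split=> [|x]; last by rewrite /w; case: eqP => // ->; rewrite vs.
    split=> [x _|]; first by rewrite ler0n.
    rewrite (big_fsetD1 v) //= /w eqxx big1_seq ?addr0 // => x.
    by rewrite !inE => /andP[_ /andP[/negbTE ->]].
  have sE (C : normedModType R) (F : A -> C) : \sum_(x <- s) w x *: F x = F v.
    rewrite (big_fsetD1 v) //= /w eqxx scale1r big1_seq ?addr0 // => x.
    by rewrite !inE => /andP[_ /andP[/negbTE -> _]]; rewrite scale0r.
  by rewrite (gP v s w) ?sE // /wsum (sE _ id).
exists g; split=> // s sK w bw.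
have : hull s (\sum_(v <- s) w v *: v) by exists w.
pose w' v := if v \in s then w v else 0.
have ww : weights s w'.
  split=> [|v /negbTE]; last by rewrite /w' => ->.
  have [w0 w1] := bw; split=> [v vs|]; first by rewrite /w' vs w0.
  by rewrite -[RHS]w1; apply: eq_big_seq => v vs; rewrite /w' vs.
move=> _; rewrite (gP _ s w') //.
  by apply: eq_big_seq => v vs; rewrite /w' vs (gv s).
by apply: eq_big_seq => v vs; rewrite /w' vs.
Qed.

End Images.

(** * Separation of sheets *)

Lemma uniform_bound (R : realType) (I : eqType) (r : seq I) (P : I -> R -> Prop) :
  (forall i mu nu, P i mu -> nu <= mu -> P i nu) ->
  (forall i, i \in r -> exists2 mu, 0 < mu & P i mu) ->
  exists2 mu, 0 < mu & forall i, i \in r -> P i mu.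
Proof.
move=> anti; elim: r => [_|i r IH h]; first by exists 1.
have [|mu mu0 hmu] := IH; first by move=> j jr; apply: h; rewrite inE jr orbT.
have [|nu nu0 hnu] := h i; first by rewrite inE eqxx.
exists (Num.min mu nu); first by rewrite lt_min mu0.
move=> j; rewrite inE => /orP[/eqP ->|/hmu pj].
  by apply: anti hnu _; rewrite ge_min lexx orbT.
by apply: anti pj _; rewrite ge_min lexx.
Qed.

Section Separation.
Variables (R : realType) (V U : normedModType R) (m : nat).
Local Notation W := 'rV[R]_m.
Variables (f : V -> W) (g : V -> U) (N : set V) (K : {fset {fset V}}) (H : seq (W -> R)).
Hypotheses (tK : triangulates K N)
  (finj : forall s x y, s \in K -> hull s x -> hull s y -> f x = f y -> x = y)
  (fgc : {within N, continuous (fun x => (f x, g x))})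
  (fginj : forall x y, N x -> N y -> f x = f y -> g x = g y -> x = y)
  (cH : forall h, h \in H -> continuous h)
  (fH : forall s x z, s \in K -> hull s x -> zle H z (f x) ->
     exists2 x', hull s x' & f x' = z).

Definition over (s : {fset V}) (y : W) : Prop := exists2 x, hull s x & f x = y.

(** The estimate that [half_space_comb] requires at each vertex. *)
Definition tilt (x x' y y' : V) : Prop :=
  `|(g x - g x') - (g y - g y')| < `|g y - g y'|.

(** This plays the role of [good] in [graded_subdivision]. The pair [y], [y'] will lie over the
    vertex with fewest nonzero functionals and [x], [x'] over another one; the clause on [over] says
    that the sheets do not meet at [f y]. *)
Definition separated (j : nat) (mu : R) (C : set W) : Prop :=
  forall s s' x x' y y', s \in K -> s' \in K -> hull s x -> hull s' x' -> hull s y -> hull s' y' ->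
  f x = f x' -> f y = f y' -> C (f y) -> (nz H (f y) <= j)%N -> ~ over (fsetI s s') (f y) ->
  sqn (f x - f y) < mu -> tilt x x' y y'.

Lemma zle_closed y : closed [set z | zle H z y].
Proof.
have -> : [set z | zle H z y] = \bigcap_(h in [set h | h \in H])
    ([set z | 0 <= h y -> 0 <= h z] `&` [set z | h y <= 0 -> h z <= 0]).
  by apply/seteqP; split=> [z zy h hH|z zy h hH]; apply: zy.
apply: closed_bigI => h /= hH; have ch := cH hH.
apply: closedI.
  have [h0|h0] := boolP (0 <= h y).
    have -> : [set z | true -> 0 <= h z] = h @^-1` [set c | 0 <= c].
      by apply/seteqP; split=> z /=; [apply|].
    by apply: preimage_closed; [move=> ? _; exact: ch|exact: closed_ge].
  by have -> : [set z | false -> 0 <= h z] = setT by apply/seteqP; split.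
have [h0|h0] := boolP (h y <= 0).
  have -> : [set z | true -> h z <= 0] = h @^-1` [set c | c <= 0].
    by apply/seteqP; split=> z /=; [apply|].
  by apply: preimage_closed; [move=> ? _; exact: ch|exact: closed_le].
by have -> : [set z | false -> h z <= 0] = setT by apply/seteqP; split.
Qed.

(* On the closure of the cell of y0, the points of C still have maximal support,
   so they stay off the merging locus [f (hull (s `&` s'))]; hence the pairs
   violating the conclusion form a compact set on which f x <> f y. *)
Lemma separated_cell s s' y0 C : s \in K -> s' \in K -> compact C ->
  ~ over (fsetI s s') y0 ->
  (forall y, C y -> (nz H y0 <= nz H y)%N) ->
  exists2 mu, 0 < mu & forall x x' y y', hull s x -> hull s' x' -> hull s y -> hull s' y' ->
    f x = f x' -> f y = f y' -> C (f y) -> zle H (f y) y0 ->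
    sqn (f x - f y) < mu -> tilt x x' y y'.
Proof.
move=> sK sK' cC no0 Cy0; have [cK NK] := tK.
pose F x := (f x, g x).
have cF t : t \in K -> compact (F @` hull t).
  move=> tK'; apply: continuous_compact; last exact: hull_compact.
  by apply: continuous_subspaceW fgc => x hx; rewrite NK; exists t.
pose T : Type := ((W * U) * (W * U)) * ((W * U) * (W * U)).
(* The violating quadruples, with [p.1] for [x], [x'] and [p.2] for [y], [y']. They are taken in the
   image of [F], since continuity is assumed for the product map; the last condition is the negation
   of [tilt], which is closed. *)
pose E : set T := ((F @` hull s `*` F @` hull s') `*` (F @` hull s `*` F @` hull s')) `&`
  [set p | sqn (p.1.1.1 - p.1.2.1) = 0] `&` [set p | sqn (p.2.1.1 - p.2.2.1) = 0] `&`
  [set p | C p.2.1.1] `&` [set p | zle H p.2.1.1 y0] `&`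
  [set p | 0 <= `|(p.1.1.2 - p.1.2.2) - (p.2.1.2 - p.2.2.2)| - `|p.2.1.2 - p.2.2.2| ].
pose ca (p : T) := p.1.1; pose cb (p : T) := p.1.2.
pose cc (p : T) := p.2.1; pose ce (p : T) := p.2.2.
have cca : continuous ca by move=> p; apply: (@continuous_comp T _ _ fst fst); exact: cvg_fst.
have ccb : continuous cb.
  by move=> p; apply: (@continuous_comp T _ _ fst snd); [exact: cvg_fst|exact: cvg_snd].
have ccc : continuous cc.
  by move=> p; apply: (@continuous_comp T _ _ snd fst); [exact: cvg_snd|exact: cvg_fst].
have cce : continuous ce by move=> p; apply: (@continuous_comp T _ _ snd snd); exact: cvg_snd.
have c1 (z : T -> W * U) : continuous z -> continuous (fun p => (z p).1).
  by move=> cz p; apply: (@continuous_comp T _ _ z fst); [exact: cz|exact: cvg_fst].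
have c2 (z : T -> W * U) : continuous z -> continuous (fun p => (z p).2).
  by move=> cz p; apply: (@continuous_comp T _ _ z snd); [exact: cz|exact: cvg_snd].
have cq (z z' : T -> W * U) : continuous z -> continuous z' ->
    continuous (fun p => sqn ((z p).1 - (z' p).1)).
  move=> cz cz' p; apply: (@continuous_comp T _ _ (fun p => (z p).1 - (z' p).1) (@sqn R m)).
    by apply: continuousB; apply: c1.
  exact: sqn_continuous.
have cn (z : T -> U) : continuous z -> continuous (fun p => `|z p|).
  move=> cz p; apply: (@continuous_comp T _ _ z (@Num.norm R U)); [exact: cz|exact: norm_continuous].
have cB (z z' : T -> U) : continuous z -> continuous z' -> continuous (fun p => z p - z' p).
  by move=> cz cz' p; exact: (continuousB (cz p) (cz' p)).
have cE : compact E.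
  apply: compact_closedI; first (apply: compact_closedI; first (apply: compact_closedI;
    first (apply: compact_closedI; first apply: compact_closedI))).
  - by apply: compact_setX; apply: compact_setX; exact: cF.
  - apply: (@preimage_closed _ _ (fun p : T => sqn (p.1.1.1 - p.1.2.1)) [set y | y = 0]).
      by move=> ? _; exact: (cq ca cb).
    exact: closed_eq.
  - apply: (@preimage_closed _ _ (fun p : T => sqn (p.2.1.1 - p.2.2.1)) [set y | y = 0]).
      by move=> ? _; exact: (cq cc ce).
    exact: closed_eq.
  - apply: (@preimage_closed _ _ (fun p : T => p.2.1.1) C).
      by move=> ? _; exact: (c1 cc).
    by apply: compact_closed => //; exact: norm_hausdorff.
  - apply: (@preimage_closed _ _ (fun p : T => p.2.1.1) [set z | zle H z y0]).
      by move=> ? _; exact: (c1 cc).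
    exact: zle_closed.
  apply: (@preimage_closed _ _ (fun p : T => `|(p.1.1.2 - p.1.2.2) - (p.2.1.2 - p.2.2.2)| -
    `|p.2.1.2 - p.2.2.2|) [set y | 0 <= y]); last exact: closed_ge.
  have cs := cB _ _ (cB _ _ (c2 _ cca) (c2 _ ccb)) (cB _ _ (c2 _ ccc) (c2 _ cce)).
  move=> p _; exact: (continuousB (cn _ cs p) (cn _ (cB _ _ (c2 _ ccc) (c2 _ cce)) p)).
pose d (p : T) : R := sqn (p.1.1.1 - p.2.1.1).
have cd : continuous d by exact: (cq ca cc).
(* If [f x = f y], then [x = y] and [x' = y'], so a violation forces [g y = g y'] and hence
   [y = y']. This point lies in the common face, and [zle_nz_eq] puts [y0] over that face, a
   contradiction. *)
have dE p : E p -> 0 < d p.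
  case: p => [[[a1 a2] [b1 b2]] [[r1 r2] [e1 e2]]].
  move=> [[[[[[[[x hx [<- <-]] [x' hx' [<- <-]]] [[y hy [<- <-]] [y' hy' [<- <-]]]] /=]]]]].
  move=> /sqn_eq0 /eqP; rewrite subr_eq0 => /eqP fx.
  move=> /sqn_eq0 /eqP; rewrite subr_eq0 => /eqP fy Cy zy nt.
  rewrite lt_def sqn_ge0 andbT; apply/eqP => /sqn_eq0/eqP; rewrite subr_eq0 => /eqP fxy.
  have xy : x = y by exact: (finj sK hx hy fxy).
  have xy' : x' = y' by apply: (finj sK') => //; rewrite -fx -fy.
  move: nt; rewrite /d xy xy' subrr normr0 sub0r oppr_ge0 normr_le0 subr_eq0 => /eqP gy.
  have yy : y = y' by apply: fginj => //; rewrite NK; [exists s|exists s'].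
  have : hull (fsetI s s') y.
    by have [_ _ <-] := cK => //; split => //; rewrite yy.
  move=> hi; apply: no0; have /hullP[w /weights_neq0 ne _] := hi.
  have siK : fsetI s s' \in K by have [_ faces _] := cK; apply: faces sK _ ne; exact: fsubsetIl.
  by apply: fH hi (zle_nz_eq zy (Cy0 _ Cy)).
have [mu mu0 hmu] : exists2 mu, 0 < mu & forall p, E p -> mu <= d p.
  have [E0|/set0P E0] := eqVneq E set0; first by exists 1 => // p; rewrite E0.
  have [|p pE hp] := compact_EVT_min E0 cE (f := d); first exact: continuous_subspaceT.
  by exists (d p); [apply: dE; rewrite inE in pE|move=> q Eq; apply: hp; rewrite inE].
exists mu => // x x' y y' hx hx' hy hy' fx fy Cy zy lt.
rewrite /tilt ltNge; apply/negP => le; move: lt; apply/negP; rewrite -leNgt.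
apply: (hmu ((F x, F x'), (F y, F y'))); rewrite /E /= fx -fy !subrr sqn0.
refine (conj (conj (conj (conj (conj _ _) _) _) _) _) => //=; last by rewrite subr_ge0.
by split; split; [exists x|exists x'|exists y|exists y'].
Qed.

(* The cells of the arrangement are indexed by finitely many sign patterns. *)
Lemma separated_ex j C : compact C -> (forall y, C y -> (j <= nz H y)%N) ->
  exists2 mu, 0 < mu & separated j mu C.
Proof.
move=> cC Cj.
pose pat (y : W) : (size H).-tuple (bool * bool) :=
  map_tuple (fun h : W -> R => (0 <= h y, h y <= 0)) (in_tuple H).
have patP y z : pat y = pat z -> zle H y z.
  move=> /(congr1 val) /= /eq_in_map e h hH.
  by have [-> ->] := e h hH.
pose P (i : {fset V} * ({fset V} * (size H).-tuple (bool * bool))) (mu : R) :=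
  forall x x' y y', hull i.1 x -> hull i.2.1 x' -> hull i.1 y -> hull i.2.1 y' ->
  f x = f x' -> f y = f y' -> C (f y) -> (nz H (f y) <= j)%N -> ~ over (fsetI i.1 i.2.1) (f y) ->
  pat (f y) = i.2.2 -> sqn (f x - f y) < mu -> tilt x x' y y'.
pose pats := enum {: (size H).-tuple (bool * bool)}.
pose r := [seq (s, p) | s <- K, p <- [seq (s', e) | s' <- K, e <- pats]].
have [|i ir|mu mu0 hmu] := @uniform_bound R _ r P.
- move=> i mu nu h le x x' y y' ? ? ? ? ? ? ? ? ? ? lt; apply: h => //.
  exact: lt_le_trans lt le.
- have /allpairsP[[s [s' e]] [/= sK /allpairsP[[s1 e1] [/= sK' _ [-> ->]]] ->]] := ir.
  (* A pattern with an admissible representative [y0] falls under [separated_cell]; for any other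
     the condition is vacuous and [mu = 1] serves. *)
  have [[y0 [ny0 no0 py0]]|no] :=
    pselect (exists y0, [/\ (nz H y0 <= j)%N, ~ over (fsetI s s1) y0 & pat y0 = e1]).
    have [|mu mu0 hmu] := separated_cell sK sK' cC no0.
      by move=> y /Cj; exact: leq_trans.
    exists mu => // x x' y y' /= hx hx' hy hy' fx fy Cy _ _ py; apply: hmu => //.
    by apply: patP; rewrite py.
  by exists 1 => // x x' y y' /= ? ? ? ? ? ? ? n1 n2 n3; exfalso; apply: no; exists (f y).
exists mu => // s s' x x' y y' sK sK' hx hx' hy hy' fx fy Cy ny no lt.
apply: (hmu (s, (s', pat (f y)))) => //.
apply/allpairsP; exists (s, (s', pat (f y))); split=> //=.
by apply/allpairsP; exists (s', pat (f y)); rewrite mem_enum.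
Qed.

End Separation.

(** * Lifting the subdivision *)

(** If the combination were 0, the total weight times [d i0] would equal minus the weighted sum of
    the [d i - d i0], whose norm is strictly smaller. *)
Lemma half_space_comb (R : realType) (U : normedModType R) (I : choiceType) (r : {fset I})
    (w : I -> R) (d : I -> U) i0 : i0 \in r -> (forall i, i \in r -> 0 < w i) ->
  (forall i, i \in r -> `|d i - d i0| < `|d i0|) -> \sum_(i <- r) w i *: d i != 0.
Proof.
move=> i0r w0 hd; apply/eqP => s0.
have e : (\sum_(i <- r) w i) *: d i0 = - \sum_(i <- r) w i *: (d i - d i0).
  under [X in - X]eq_bigr do rewrite scalerBr.
  by rewrite sumrB s0 sub0r opprK scaler_suml.
have : 0 < \sum_(i <- r) w i * (`|d i0| - `|d i - d i0|).
  rewrite (big_fsetD1 i0) //= ltr_wpDr //; last by rewrite mulr_gt0 ?w0 // subr_gt0 hd.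
  rewrite big_seq; apply: sumr_ge0 => i; rewrite !inE => /andP[_ ir].
  by rewrite mulr_ge0 ?(ltW (w0 i ir)) // subr_ge0 ltW // hd.
under eq_bigr do rewrite mulrBr.
rewrite sumrB -mulr_suml subr_gt0 ltNge; apply/negP; rewrite negbK.
have W0 : 0 <= \sum_(i <- r) w i by rewrite big_seq; apply: sumr_ge0 => i /w0/ltW.
rewrite -[X in X * _](ger0_norm W0) -normrZ e normrN.
apply: le_trans (ler_norm_sum _ _ _) _; rewrite big_seq [leRHS]big_seq.
by apply: ler_sum => i ir; rewrite normrZ ger0_norm // ltW // w0.
Qed.

Section Lift.
Variables (R : realType) (V W U : normedModType R) (f : V -> W).
Variables (K : {fset {fset V}}) (S : {fset {fset W}}).
Local Notation over s y := (exists2 x, hull s x & f x = y).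
Hypotheses (cK : simplicial_complex K) (cS : simplicial_complex S)
  (fK : forall s, s \in K -> linear_on s f)
  (finj : forall s x y, s \in K -> hull s x -> hull s y -> f x = f y -> x = y)
  (fS : forall x, space K x -> space S (f x))
  (subS : forall s t w v, s \in K -> t \in S -> weights t w -> over s (wsum t w) ->
     w v != 0 -> over s v).

(** A section of [f] over the image of each simplex [s], unconstrained elsewhere; [finj] makes it
    unique there. *)
Variable lam : {fset V} -> W -> V.
Hypothesis lamP : forall s y, over s y -> hull s (lam s y) /\ f (lam s y) = y.

Definition liftable (s : {fset V}) (t : {fset W}) : Prop := forall v, v \in t -> over s v.

Lemma lam_inj s t : liftable s t -> {in t &, injective (lam s)}.
Proof.
by move=> st x y /st/lamP[_ {2}<-] /st/lamP[_ {2}<-] ->.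
Qed.

Lemma lift_comb s t w : s \in K -> liftable s t -> weights t w ->
  hull s (\sum_(v <- t) w v *: lam s v) /\ f (\sum_(v <- t) w v *: lam s v) = wsum t w.
Proof.
move=> sK st [[w0 w1] _]; have hl v : v \in t -> hull s (lam s v) by move=> /st/lamP[].
split; first exact: hull_convex.
rewrite (linear_on_comb (fK sK)) //.
by apply: eq_big_seq => v /st/lamP[_ ->].
Qed.

(** Nonzero weights put each vertex of [t] over [s] by [subS]. The lifted combination then has the
    same image as [x], and [f] is injective on [hull s]. *)
Lemma lift_point s t w x : s \in K -> hull s x -> t \in S -> weights t w ->
  (forall v, v \in t -> w v != 0) -> f x = wsum t w ->
  liftable s t /\ x = \sum_(v <- t) w v *: lam s v.
Proof.
move=> sK hx tS wt wn fx.
have st : liftable s t.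
  by move=> v vt; apply: (subS sK tS wt) (wn v vt); exists x.
split=> //; have [h1 h2] := lift_comb sK st wt.
by apply: (finj sK hx h1); rewrite h2.
Qed.

(** Passing to the support makes every weight nonzero, as [lift_point] requires. *)
Lemma carrier x : space K x -> exists t w, [/\ t \in S, weights t w,
  forall v, v \in t -> w v != 0 & f x = wsum t w].
Proof.
move=> /fS[t tS /hullP[w wt fx]]; have ws := weights_supp wt.
exists (supp t w), w; split=> //; last by rewrite fx wsum_supp.
  have /complexP[_ faces _] := cS.
  by apply: faces tS (supp_sub _ _) (weights_neq0 ws).
by move=> v; rewrite !inE => /andP[].
Qed.

Definition lift_complex : {fset {fset V}} :=
  (\bigcup_(s <- K) ((fun t : {fset W} => (lam s @` t)%fset) @`
     [fset t in S | `[< liftable s t >]]))%fset.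

Lemma lift_complexP r : r \in lift_complex <->
  exists s t, [/\ s \in K, t \in S, liftable s t & r = (lam s @` t)%fset].
Proof.
split=> [/bigfcupP[s /andP[sK _]] /imfsetP[t /=]|[s [t [sK tS st ->]]]].
  by rewrite !inE => /andP[tS /asboolP st] ->; exists s, t.
apply/bigfcupP; exists s; rewrite ?sK //.
by apply/imfsetP; exists t => //=; rewrite !inE tS; apply/asboolP.
Qed.

(** A point shared by two lifted simplices has one image in the space of [S], so the pulled-back
    weights agree; it remains to match the vertices of the two lifts. *)
Lemma lift_triangulates : triangulates lift_complex (space K).
Proof.
have /complexP[neS facesS unS] := cS; have [_ facesK interK] := cK.
split; last first.
  apply/seteqP; split=> [x Kx|x [r /lift_complexP[s [t [sK tS st ->]]] hx]].
    have [s sK hx] := Kx; have [t [w [tS wt wn fx]]] := carrier Kx.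
    have [st xE] := lift_point sK hx tS wt wn fx.
    exists (lam s @` t)%fset; first by apply/lift_complexP; exists s, t.
    rewrite xE; have [[w0 w1] _] := wt.
    by apply: hull_convex => // v vt; apply: hull_vertex; exact: in_imfset.
  exists s => //; apply: hull_hull hx => _ /imfsetP[v vt ->].
  by have [] := lamP (st v vt).
apply/complexP; split.
- move=> r /lift_complexP[s [t [sK tS st ->]]]; have /fset0Pn[v vt] := neS t tS.
  by apply/fset0Pn; exists (lam s v); exact: in_imfset.
- move=> r r' /lift_complexP[s [t [sK tS st ->]]] sub r0.
  apply/lift_complexP; exists s, [fset v in t | lam s v \in r']%fset; split=> //.
  + apply: facesS tS _ _; first by apply/fsubsetP => v; rewrite !inE => /andP[].
    have /fset0Pn[y yr] := r0; have /imfsetP[v /= vs ev] := fsubsetP sub y yr.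
    by apply/fset0Pn; exists v; rewrite !inE vs -ev.
  + by move=> v; rewrite !inE => /andP[/st].
  + apply/fsetP => y; apply/idP/imfsetP => /= [yr|[v]].
      have /imfsetP[v vs ev] := fsubsetP sub y yr.
      by exists v => //; rewrite !inE vs -ev.
    by rewrite !inE => /andP[_ vr] ->.
move=> r r' w w' /lift_complexP[s [t [sK tS st ->]]] /lift_complexP[s' [t' [sK' tS' st' ->]]].
move=> ww ww' e.
have [c tc [cE ec cw]] := imfset_weights (lam_inj st) ww.
have [c' tc' [cE' ec' cw']] := imfset_weights (lam_inj st') ww'.
have [h1 f1] := lift_comb sK st tc; have [h2 f2] := lift_comb sK' st' tc'.
have cc : c =1 c' by apply: (unS t t') => //; rewrite -f1 -f2 -ec -ec' e.
rewrite -ec in h1 f1; rewrite -ec' -e in h2 f2.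
have hi : hull (fsetI s s') (wsum (lam s @` t)%fset w) by rewrite -interK.
have siK : fsetI s s' \in K.
  have /hullP[z /weights_neq0 ne _] := hi; apply: facesK sK _ ne; exact: fsubsetIl.
(* A vertex carrying weight lies below the common face, where both lifts agree. *)
have lamE v : c v != 0 -> lam s v = lam s' v.
  move=> cv; have [x hx fx] : over (fsetI s s') v.
    by apply: (subS siK tS tc) cv; exists (wsum (lam s @` t)%fset w).
  have xs : hull s x by apply: hull_sub hx; exact: fsubsetIl.
  have xs' : hull s' x by apply: hull_sub hx; exact: fsubsetIr.
  have [l1 l2] : hull s (lam s v) /\ f (lam s v) = v by apply: lamP; exists x.
  have [l1' l2'] : hull s' (lam s' v) /\ f (lam s' v) = v by apply: lamP; exists x.
  transitivity x; first by apply: (finj sK) => //; rewrite l2.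
  by apply: (finj sK') => //; rewrite l2'.
move=> y; have [wy|wy] := eqVneq (w y) 0.
  have [w'y|w'y] := eqVneq (w' y) 0; first by rewrite wy.
  have [v vt' [yE cvE]] := cw' y w'y.
  have cv : c v != 0 by rewrite cc cvE.
  have vt : v \in t by apply: contraNT cv => vt; case: tc => _ ->.
  by rewrite -cvE -cc yE cE // lamE.
have [v vt [yE cvE]] := cw y wy.
have cv : c v != 0 by rewrite cvE.
have vt' : v \in t' by apply: contraNT cv => vt'; rewrite cc; case: tc' => _ ->.
by rewrite -cvE cc yE cE' // lamE.
Qed.

Lemma lift_linear r : r \in lift_complex -> linear_on r f.
Proof.
move=> /lift_complexP[s [t [sK tS st ->]]] w [w0 w1].
apply: (linear_on_comb (fK sK)) => // _ /imfsetP[v vt ->].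
by have [] := lamP (st v vt).
Qed.

(** Points with the same image share a carrier and its weights, and differ only in their sheets. The
    difference of their [g']-values is the weighted sum of the sheet differences of [g], where
    vertices at which the sheets agree contribute 0. *)
Lemma lift_injective (g g' : V -> U) :
  (forall r, r \in lift_complex -> linear_on r g') ->
  (forall r v, r \in lift_complex -> v \in r -> g' v = g v) ->
  (forall s s' t, s \in K -> s' \in K -> t \in S -> liftable s t -> liftable s' t ->
     (exists2 v, v \in t & lam s v != lam s' v) ->
     exists v0, [/\ v0 \in t, lam s v0 != lam s' v0 &
       forall v, v \in t -> lam s v != lam s' v ->
       `|(g (lam s v) - g (lam s' v)) - (g (lam s v0) - g (lam s' v0))| <
       `|g (lam s v0) - g (lam s' v0)|]) ->
  forall x x', space K x -> space K x' -> (f x, g' x) = (f x', g' x') -> x = x'.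
Proof.
move=> lg' gg' sep x x' Kx Kx' [fxx gxx].
have [s sK hx] := Kx; have [s' sK' hx'] := Kx'.
have [t [w [tS wt wn fx]]] := carrier Kx.
have [st xE] := lift_point sK hx tS wt wn fx.
have [st' xE'] := lift_point sK' hx' tS wt wn (etrans (esym fxx) fx).
have [[w0 w1] wN] := wt.
have g'E q : q \in K -> liftable q t ->
    g' (\sum_(v <- t) w v *: lam q v) = \sum_(v <- t) w v *: g (lam q v).
  move=> qK qt; have rK : (lam q @` t)%fset \in lift_complex.
    by apply/lift_complexP; exists q, t.
  rewrite (linear_on_comb (lg' _ rK)) //; last first.
    by move=> v vt; apply: hull_vertex; exact: in_imfset.
  by apply: eq_big_seq => v vt; rewrite (gg' _ _ rK) //; exact: in_imfset.
have [ex|nex] := pselect (exists2 v, v \in t & lam s v != lam s' v); last first.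
  rewrite xE xE'; apply: eq_big_seq => v vt; congr (_ *: _); apply/eqP/negPn/negP => ne.
  by apply: nex; exists v.
exfalso; have [v0 [v0t ne0 hv0]] := sep s s' t sK sK' tS st st' ex.
pose r : {fset W} := [fset v in t | lam s v != lam s' v]%fset.
pose d v := g (lam s v) - g (lam s' v).
have : \sum_(v <- r) w v *: d v != 0.
  apply: (@half_space_comb _ _ _ r w d v0); first by rewrite !inE v0t.
    by move=> v; rewrite !inE => /andP[vt _]; rewrite lt_def wn // w0.
  by move=> v; rewrite !inE => /andP[vt ne]; exact: hv0.
apply/negP; rewrite negbK; apply/eqP.
transitivity (\sum_(v <- t) w v *: d v).
  apply: big_fset_incl; first by apply/fsubsetP => v; rewrite !inE => /andP[].
  by move=> v vt; rewrite !inE vt /= negbK /d => /eqP ->; rewrite subrr scaler0.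
under eq_bigr do rewrite scalerBr.
by rewrite sumrB -!g'E // -xE -xE' gxx subrr.
Qed.

End Lift.

(** * Assembly of the PL embedding *)

Section Assembly.
Variables (R : realType) (V : normedModType R) (m : nat) (U : normedModType R).
Local Notation W := 'rV[R]_m.

Lemma linear_on_pair (A B C : normedModType R) (s : {fset A}) (f : A -> B) (g : A -> C) :
  linear_on s f -> linear_on s g -> linear_on s (fun x => (f x, g x)).
Proof.
move=> fs gs w bw; rewrite fs // gs //.
by elim/big_rec3: _ => // v a b c _ <-.
Qed.

(** The functionals of all image simplices are concatenated, since a longer list only strengthens
    [zle]. The induction runs over the underlying list because a part of [K] need not be a
    complex. *)
Lemma complex_functionals (f : V -> W) (K : {fset {fset V}}) :
  simplicial_complex K -> (forall s, s \in K -> linear_on s f) ->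
  (forall s x y, s \in K -> hull s x -> hull s y -> f x = f y -> x = y) ->
  exists H : seq (W -> R), [/\ forall h, h \in H -> affine_fun h,
    forall h, h \in H -> continuous h &
    forall s x z, s \in K -> hull s x -> zle H z (f x) -> exists2 x', hull s x' & f x' = z].
Proof.
move=> [simp _ _] fK finj.
suff [H [aH cH HP]] : exists H : seq (W -> R), [/\ forall h, h \in H -> affine_fun h,
    forall h, h \in H -> continuous h & forall s, s \in (K : seq _) ->
    forall y z, hull (f @` s)%fset y -> zle H z y -> hull (f @` s)%fset z].
  exists H; split=> // s x z sK hx zx; apply/image_hull; first exact: fK.
  apply: (HP s sK (f x)) => //; apply/image_hull; [exact: fK|by exists x].
have : forall s, s \in (K : seq _) -> s \in K by [].
elim: (K : seq _) => [_|s r IH sub]; first by exists [::].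
have [|H [aH cH HP]] := IH; first by move=> t tr; apply: sub; rewrite inE tr orbT.
have sK : s \in K by apply: sub; rewrite inE eqxx.
have [_ ai] := simp s sK.
have [H' [aH' cH' HP']] := hull_functionals (image_independent ai (fK s sK) (fun x y => @finj s x y sK)).
exists (H' ++ H); split.
- by move=> h; rewrite mem_cat => /orP[/aH'|/aH].
- by move=> h; rewrite mem_cat => /orP[/cH'|/cH].
move=> t; rewrite inE => /orP[/eqP ->|tr] y z hy zy.
  by apply: HP' hy _ => h hH; apply: zy; rewrite mem_cat hH.
by apply: HP hy _ => // h hH; apply: zy; rewrite mem_cat hH orbT.
Qed.

Lemma PL_prem_of_injective (N : set V) (M : set W) (K : {fset {fset V}})
    (f : V -> W) (g : V -> U) :
  triangulates K N -> (forall s, s \in K -> linear_on s f) ->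
  (forall s x y, s \in K -> hull s x -> hull s y -> f x = f y -> x = y) ->
  f @` N `<=` M -> {within N, continuous (fun x => (f x, g x))} ->
  (forall x y, N x -> N y -> f x = f y -> g x = g y -> x = y) ->
  exists g' : V -> U, PL_embedding N (M `*` [set: U]) (fun x => (f x, g' x)).
Proof.
move=> tK fK finj fNM fgc fginj; have [cK NK] := tK.
have [_ _ interK] := cK.
have [H [aH cH fH]] := complex_functionals cK fK finj.
have [S0 [cS0 XS0]] : exists S0, simplicial_complex S0 /\ f @` space K `<=` space S0.
  apply: big_simplex_ex; apply: continuous_compact; last exact: space_compact.
  exact: linear_space_continuous.
(* Here [good] becomes [separated], with bounds supplied by [separated_ex]. *)
have [S [cS sS nS gS]] := graded_subdivision aH cS0
  (fun j C => separated_ex tK finj fgc fginj cH fH (j := j) (C := C)).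
have /choice[lam lamP'] : forall p : {fset V} * W, exists x, over f p.1 p.2 -> hull p.1 x /\ f x = p.2.
  move=> [s y]; have [[x hx fx]|] := pselect (over f s y); first by exists x.
  by exists 0.
pose l s y := lam (s, y).
have lamP s y : over f s y -> hull s (l s y) /\ f (l s y) = y by exact: (lamP' (s, y)).
have fS x : space K x -> space S (f x) by move=> Kx; rewrite sS; apply: XS0; exists x.
have subS s t w v : s \in K -> t \in S -> weights t w -> over f s (wsum t w) ->
    w v != 0 -> over f s v.
  move=> sK tS wt [x hx fx] wv; apply: (fH s x) => //; rewrite fx.

  exact: (zle_vertex aH cS nS tS wt wv).
have tL := lift_triangulates cK cS fK finj fS subS lamP.
have [cL _] := tL.
have [g' [lg' gg']] := linear_extension g cL.
exists g'; apply: (@PL_embedding_of_injective _ _ _ (lift_complex f K S l)).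
- by rewrite NK.
- by move=> r rL; apply: linear_on_pair; [exact: (lift_linear fK lamP rL)|exact: lg'].
- by move=> _ [x Nx <-]; split=> //; apply: fNM; exists x.
have NK' : N = space K := NK.
rewrite NK' => x y Kx Ky; apply: (lift_injective cS fK finj fS subS lamP lg' gg') => //.
move=> s s' t sK sK' tS st st' [v1 v1t ne1].
(* Among the vertices where the sheets differ, [v0] has the fewest nonzero functionals. Its level
   [j] selects the stage to use, and minimality puts every other such vertex at level at least
   [j]. *)
pose P j := `[< exists v, [/\ v \in t, l s v != l s' v & nz H v = j] >].
have exP : exists j, P j by exists (nz H v1); apply/asboolP; exists v1.
case: (ex_minnP exP) => j /asboolP[v0 [v0t ne0 nz0]] jmin.
exists v0; split=> // v vt ne.
have jH : (j <= size H)%N by rewrite -nz0 count_size.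
have [mu [C [sep [mu0 short ins]]]] := gS j jH.
have [e1 e2] := lamP _ _ (st v vt); have [e1' e2'] := lamP _ _ (st' v vt).
have [q1 q2] := lamP _ _ (st v0 v0t); have [q1' q2'] := lamP _ _ (st' v0 v0t).
have v0S : [fset v0]%fset \in S.
  have /complexP[_ faces _] := cS; apply: faces tS _ _; first by rewrite fsub1set.
  by apply/fset0Pn; exists v0; rewrite !inE.
apply: (sep s s') => //; rewrite ?e2 ?q2 ?e2' ?q2' ?nz0 //.
(* The vertex [v0] is itself a simplex with all vertices at level [j], so it lies in [C]. *)
- apply: (ins _ v0S); last by apply: hull_vertex; rewrite !inE.
  by move=> u; rewrite !inE => /eqP ->; rewrite nz0.
(* A preimage in the common face would coincide with both lifts of [v0]. *)
- move=> [z]; rewrite -interK // => -[zs zs'] fz; move: ne0.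
  have -> : l s v0 = z by apply: (finj s) => //; rewrite q2.
  have -> : l s' v0 = z by apply: (finj s') => //; rewrite q2'.
  by rewrite eqxx.
apply: short; last by rewrite nz0.
  exact: edge_face cS tS vt v0t.
by apply: jmin; apply/asboolP; exists v.
Qed.

End Assembly.

Theorem theorem1 (R : realType) (n m k : nat)
    (N : set 'rV[R]_n) (M : set 'rV[R]_m) (f : 'rV[R]_n -> 'rV[R]_m)
    (hN : compact_polyhedron N) (hM : compact_polyhedron M)
    (hf : PL_map N M f) (hnd : non_degenerate N f) :
  topological_prem k N M f <-> PL_prem k N M f.
Proof.
split=> [[g [[_ fgc] [G _ GF]]]|[g /PL_embedding_topological fg]]; last by exists g.
have [fNM [K tK fK]] := hf.
have finj := nondegenerate_injective hnd tK fK.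
apply: (PL_prem_of_injective tK fK finj fNM fgc) => x y Nx Ny fxy gxy.
by rewrite -(GF x Nx) -(GF y Ny) /= fxy gxy.
Qed.
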